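(* Expressed in the coordinates $\mathcal K$, the function $h_2$ is renormalizably integrable via $\mathrm E_0$. Namely, there exists a function $\widetilde h_2$ such that $$h_2(\mathrm r_1,\Lambda_2,\Theta,\mathrm G_2,\mathrm g_2)=\widetilde h_2\big(\mathrm r_1,\Lambda_2,\Theta,\mathrm E_0(\mathrm r_1,\Lambda_2,\Theta,\mathrm G_2,\mathrm g_2)\big).$$
   Context: Let $(y^{(i)},x^{(i)})\in\mathbb R^3\times\mathbb R^3$, $i=1,2$, and let $\mathrm m_2,\mathrm M_2>0$. Consider points where $\frac{\|y^{(2)}\|^2}{2\mathrm m_2}-\frac{\mathrm m_2\mathrm M_2}{\|x^{(2)}\|}<0$ and the Keplerian ellipse generated by this Hamiltonian through $(y^{(2)},x^{(2)})$ has non-zero eccentricity; $a_2$ is its semi-major axis and $\mathrm P^{(2)}$ the unit direction of its perihelion. Put $\mathrm C^{(i)}=x^{(i)}\times y^{(i)}$, $\mathrm C=\mathrm C^{(1)}+\mathrm C^{(2)}$. Coordinates $\mathcal K$: fix an orthonormal frame $(\mathrm i,\mathrm j,\mathrm k)$; put $\nu_0=\mathrm k\times\mathrm C$, $\nu_1=\mathrm C\times x^{(1)}$, $\nu_2=x^{(1)}\times\mathrm C^{(2)}$, $\nu_3=\mathrm C^{(2)}\times\mathrm P^{(2)}$, assumed non-zero; for $a,b$ in the plane orthogonal to $w$ let $\alpha_w(a,b)$ be the angle from $a$ to $b$ mod $2\pi$ oriented by the right-hand rule about $w$. The canonical coordinates $\mathcal K$ are: impulses $\mathrm Z=\mathrm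 C\cdot\mathrm k$, $\mathrm G=\|\mathrm C\|$, $\mathrm R_1=y^{(1)}\cdot x^{(1)}/\|x^{(1)}\|$, $\Lambda_2=\mathrm m_2\sqrt{\mathrm M_2a_2}$, $\mathrm G_2=\|\mathrm C^{(2)}\|$, $\Theta=\mathrm C^{(2)}\cdot x^{(1)}/\|x^{(1)}\|$, with respective conjugate coordinates $\mathrm z=\alpha_{\mathrm k}(\mathrm i,\nu_0)$, $\mathrm g=\alpha_{\mathrm C}(\nu_0,\nu_1)$, $\mathrm r_1=\|x^{(1)}\|$, $\mathrm l_2=$ mean anomaly of $x^{(2)}$ on its ellipse, $\mathrm g_2=\alpha_{\mathrm C^{(2)}}(\nu_2,\nu_3)$, $\vartheta=\alpha_{x^{(1)}}(\nu_1,\nu_2)$. In these coordinates, the partially averaged Newtonian potential $h_2=\frac1{2\pi}\int_{\mathbb T}\frac{d\mathrm l_2}{\|x^{(1)}-x^{(2)}\|}$ ($\mathbb T=\mathbb R/2\pi\mathbb Z$) is $$h_2(\mathrm r_1,\Lambda_2,\Theta,\mathrm G_2,\mathrm g_2)=\frac1{2\pi}\int_{\mathbb T}\frac{\varrho_2\,d\zeta_2}{\sqrt{\mathrm r_1^2+2\mathrm r_1a_2\sqrt{1-\frac{\Theta^2}{\mathrm G_2^2}}\Big(\cos\mathrm g_2\big(\cos\zeta_2-\sqrt{1-\tfrac{\mathrm G_2^2}{\Lambda_2^2}}\big)-\frac{\mathrm G_2}{\Lambda_2}\sin\mathrm g_2\sin\zeta_2\Big)+a_2^2\varrho_2^2}},$$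 with $\varrho_2=1-\sqrt{1-\mathrm G_2^2/\Lambda_2^2}\cos\zeta_2$, and $$\mathrm E_0(\mathrm r_1,\Lambda_2,\Theta,\mathrm G_2,\mathrm g_2)=\mathrm G_2^2+\mathrm m_2^2\mathrm M_2\mathrm r_1\sqrt{1-\frac{\mathrm G_2^2}{\Lambda_2^2}}\sqrt{1-\frac{\Theta^2}{\mathrm G_2^2}}\cos\mathrm g_2 .$$ ($h_2$ is considered where it is well defined and smooth, i.e. $x^{(1)}$ is not on the ellipse.) Renormalizable integrability: let $h(p,q,y,x)=\widehat h(\mathrm I(p,q),y,x)$ and $g(p,q,y,x)=\widehat g(\mathrm I(p,q),y,x)$ with $(p,q)\in\mathcal B$, $(y,x)\in U\subset\mathbb R^2$, canonical coordinates, and $\mathrm I=(\mathrm I_1,\dots,\mathrm I_n)$ pairwise Poisson-commuting functions of $(p,q)\in\mathbb R^{2n}$. Then $h$ is renormalizably integrable via $g$ if there is a function $\widetilde h$ with $h(p,q,y,x)=\widetilde h(\mathrm I(p,q),\widehat g(\mathrm I(p,q),y,x))$ for all $(p,q,y,x)$. Here $n=3$, $\mathrm I=(\mathrm r_1,\Lambda_2,\Theta)$, $y=\mathrm G_2$, $x=\mathrm g_2$. *)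

(* Defs.v *)
From mathcomp Require Import all_boot.
From Stdlib Require Import Reals ClassicalEpsilon.
From Coquelicot Require Import Coquelicot.

Set Implicit Arguments.
Unset Strict Implicit.
Unset Printing Implicit Defensive.

Open Scope R_scope.

Definition vec3 : Type := (R * R * R)%type.

Definition vzero : vec3 := (0, 0, 0).

Definition vadd (u v : vec3) : vec3 :=
  let '(u1, u2, u3) := u in let '(v1, v2, v3) := v in (u1 + v1, u2 + v2, u3 + v3).

Definition vscale (c : R) (u : vec3) : vec3 :=
  let '(u1, u2, u3) := u in (c * u1, c * u2, c * u3).

Definition vsub (u v : vec3) : vec3 := vadd u (vscale (-1) v).

Definition vdot (u v : vec3) : R :=
  let '(u1, u2, u3) := u in let '(v1, v2, v3) := v in u1 * v1 + u2 * v2 + u3 * v3.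

Definition vcross (u v : vec3) : vec3 :=
  let '(u1, u2, u3) := u in let '(v1, v2, v3) := v in
  (u2 * v3 - u3 * v2, u3 * v1 - u1 * v3, u1 * v2 - u2 * v1).

Definition vnorm (u : vec3) : R := sqrt (vdot u u).

Definition vunit (u : vec3) : vec3 := vscale (/ vnorm u) u.

Record frame := Frame { f_i : vec3; f_j : vec3; f_k : vec3 }.

Definition orthonormal (F : frame) : Prop :=
  (vdot (f_i F) (f_i F) = 1 /\ vdot (f_j F) (f_j F) = 1 /\ vdot (f_k F) (f_k F) = 1) /\
  (vdot (f_i F) (f_j F) = 0 /\ vdot (f_j F) (f_k F) = 0 /\ vdot (f_k F) (f_i F) = 0).

(* [t] is a representative modulo 2 PI of the angle from [a] to [b] in the plane
   orthogonal to [w], oriented by the right-hand rule about [w]. *)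
Definition oriented_angle (w a b : vec3) (t : R) : Prop :=
  vunit b = vadd (vscale (cos t) (vunit a))
                 (vscale (sin t) (vcross (vunit w) (vunit a))).

Definition ang_mom (y x : vec3) : vec3 := vcross x y.

(* The Kepler problem with Hamiltonian |y|^2 / (2 m) - m M / |x|; the equations of
   motion are x'' = - M x / |x|^3 with y = m x'. *)

Definition kepler_energy (m M : R) (y x : vec3) : R :=
  (vnorm y) ^ 2 / (2 * m) - m * M / vnorm x.

(* From energy = - m M / (2 a). *)
Definition semi_major (m M : R) (y x : vec3) : R :=
  - (m * M) / (2 * kepler_energy m M y x).

(* The Laplace-Runge-Lenz vector: its length is the eccentricity, and it points
   from the focus (the origin) to the perihelion. *)
Definition ecc_vector (m M : R) (y x : vec3) : vec3 :=
  vsub (vscale (/ (m ^ 2 * M)) (vcross y (ang_mom y x))) (vunit x).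

Definition eccentricity (m M : R) (y x : vec3) : R := vnorm (ecc_vector m M y x).

Definition perihelion_dir (m M : R) (y x : vec3) : vec3 := vunit (ecc_vector m M y x).

(* The point of eccentric anomaly [zeta] on the ellipse through (y, x); the motion
   is in the sense of increasing [zeta]. *)
Definition kepler_point (m M : R) (y x : vec3) (zeta : R) : vec3 :=
  let a := semi_major m M y x in
  let e := eccentricity m M y x in
  let P := perihelion_dir m M y x in
  let Q := vcross (vunit (ang_mom y x)) P in
  vadd (vscale (a * (cos zeta - e)) P)
       (vscale (a * sqrt (1 - e ^ 2) * sin zeta) Q).

Definition mean_anomaly_of (e zeta : R) : R := zeta - e * sin zeta.

(* For 0 <= e < 1 this is the inverse of [mean_anomaly_of e], i.e. the unique
   solution of Kepler's equation. *)
Definition eccentric_anomaly (e l : R) : R :=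
  epsilon (inhabits 0) (fun zeta => mean_anomaly_of e zeta = l).

Definition kepler_position (m M : R) (y x : vec3) (l : R) : vec3 :=
  kepler_point m M y x (eccentric_anomaly (eccentricity m M y x) l).

Definition is_mean_anomaly (m M : R) (y x : vec3) (l : R) : Prop :=
  exists zeta, x = kepler_point m M y x zeta /\
               l = mean_anomaly_of (eccentricity m M y x) zeta.

Record phase_point := PhasePoint { y1 : vec3; x1 : vec3; y2 : vec3; x2 : vec3 }.

Definition h2 (m2 M2 : R) (s : phase_point) : R :=
  / (2 * PI) *
  RInt (fun l => / vnorm (vsub (x1 s) (kepler_position m2 M2 (y2 s) (x2 s) l)))
       0 (2 * PI).

Definition off_ellipse (m2 M2 : R) (s : phase_point) : Prop :=
  forall zeta, x1 s <> kepler_point m2 M2 (y2 s) (x2 s) zeta.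

Record Kcoords := KCoords {
  cZ : R; cG : R; cR1 : R; cLambda2 : R; cG2 : R; cTheta : R;
  cz : R; cg : R; cr1 : R; cl2 : R; cg2 : R; ctheta : R }.

Definition C1 (s : phase_point) : vec3 := ang_mom (y1 s) (x1 s).
Definition C2 (s : phase_point) : vec3 := ang_mom (y2 s) (x2 s).
Definition Ctot (s : phase_point) : vec3 := vadd (C1 s) (C2 s).

Definition nu0 (F : frame) (s : phase_point) : vec3 := vcross (f_k F) (Ctot s).
Definition nu1 (s : phase_point) : vec3 := vcross (Ctot s) (x1 s).
Definition nu2 (s : phase_point) : vec3 := vcross (x1 s) (C2 s).
Definition nu3 (m2 M2 : R) (s : phase_point) : vec3 :=
  vcross (C2 s) (perihelion_dir m2 M2 (y2 s) (x2 s)).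

Definition K_admissible (F : frame) (m2 M2 : R) (s : phase_point) : Prop :=
  (x2 s <> vzero /\
   kepler_energy m2 M2 (y2 s) (x2 s) < 0 /\
   eccentricity m2 M2 (y2 s) (x2 s) <> 0) /\
  (nu0 F s <> vzero /\ nu1 s <> vzero /\ nu2 s <> vzero /\ nu3 m2 M2 s <> vzero).

(* The angles are determined modulo 2 PI, so this is a relation: [k] is any
   representative of the coordinates of [s]. *)
Definition K_coordinates (F : frame) (m2 M2 : R) (s : phase_point) (k : Kcoords) : Prop :=
  K_admissible F m2 M2 s /\
  (cZ k = vdot (Ctot s) (f_k F) /\
   cG k = vnorm (Ctot s) /\
   cR1 k = vdot (y1 s) (x1 s) / vnorm (x1 s) /\
   cLambda2 k = m2 * sqrt (M2 * semi_major m2 M2 (y2 s) (x2 s)) /\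
   cG2 k = vnorm (C2 s) /\
   cTheta k = vdot (C2 s) (x1 s) / vnorm (x1 s)) /\
  (oriented_angle (f_k F) (f_i F) (nu0 F s) (cz k) /\
   oriented_angle (Ctot s) (nu0 F s) (nu1 s) (cg k) /\
   cr1 k = vnorm (x1 s) /\
   is_mean_anomaly m2 M2 (y2 s) (x2 s) (cl2 k) /\
   oriented_angle (C2 s) (nu2 s) (nu3 m2 M2 s) (cg2 k) /\
   oriented_angle (x1 s) (nu1 s) (nu2 s) (ctheta k)).

(* From Lambda2 = m2 sqrt (M2 a2). *)
Definition a2K (m2 M2 Lambda2 : R) : R := Lambda2 ^ 2 / (m2 ^ 2 * M2).

Definition rho2 (Lambda2 G2 zeta : R) : R :=
  1 - sqrt (1 - G2 ^ 2 / Lambda2 ^ 2) * cos zeta.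

(* The squared distance between x1 and the point of eccentric anomaly [zeta]. *)
Definition dist2K (m2 M2 r1 Lambda2 Theta G2 g2 zeta : R) : R :=
  let a2 := a2K m2 M2 Lambda2 in
  r1 ^ 2
  + 2 * r1 * a2 * sqrt (1 - Theta ^ 2 / G2 ^ 2)
    * (cos g2 * (cos zeta - sqrt (1 - G2 ^ 2 / Lambda2 ^ 2))
       - G2 / Lambda2 * sin g2 * sin zeta)
  + a2 ^ 2 * (rho2 Lambda2 G2 zeta) ^ 2.

Definition h2K (m2 M2 r1 Lambda2 Theta G2 g2 : R) : R :=
  / (2 * PI) *
  RInt (fun zeta => rho2 Lambda2 G2 zeta
                    / sqrt (dist2K m2 M2 r1 Lambda2 Theta G2 g2 zeta))
       0 (2 * PI).

Definition E0 (m2 M2 r1 Lambda2 Theta G2 g2 : R) : R :=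
  G2 ^ 2
  + m2 ^ 2 * M2 * r1 * sqrt (1 - G2 ^ 2 / Lambda2 ^ 2)
    * sqrt (1 - Theta ^ 2 / G2 ^ 2) * cos g2.

(* |Theta| < G2 expresses nu2 <> 0, G2 < Lambda2 the non-zero eccentricity, and the
   last condition that x1 is not on the ellipse. *)
Definition K_domain (m2 M2 r1 Lambda2 Theta G2 g2 : R) : Prop :=
  0 < r1 /\ Rabs Theta < G2 /\ G2 < Lambda2 /\
  forall zeta, 0 < dist2K m2 M2 r1 Lambda2 Theta G2 g2 zeta.

Definition Rn (n : nat) : Type := 'I_n -> R.

Definition upd n (v : Rn n) (i : 'I_n) (t : R) : Rn n :=
  fun j => if j == i then t else v j.

Definition has_partials n (f : Rn n -> Rn n -> R) (p q : Rn n) : Prop :=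
  forall i : 'I_n,
    ex_derive (fun t => f (upd p i t) q) (p i) /\
    ex_derive (fun t => f p (upd q i t)) (q i).

Definition poisson n (f g : Rn n -> Rn n -> R) (p q : Rn n) : R :=
  \big[Rplus/0]_(i < n)
    (Derive (fun t => f p (upd q i t)) (q i) * Derive (fun t => g (upd p i t) q) (p i)
     - Derive (fun t => f (upd p i t) q) (p i) * Derive (fun t => g p (upd q i t)) (q i)).

(* The set [D] of points (p, q, y, x) is not required to be a product B x U: the
   ranges of the coordinates may depend on each other. *)
Definition commuting_on n (D : Rn n -> Rn n -> R -> R -> Prop)
    (I : 'I_n -> Rn n -> Rn n -> R) : Prop :=
  forall p q y x, D p q y x ->
    (forall i, has_partials (I i) p q) /\
    (forall i j, poisson (I i) (I j) p q = 0).

(* Renormalizable integrability on [D] of h = hhat (I (p, q), y, x) via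
   g = ghat (I (p, q), y, x). *)
Definition renormalizably_integrable n (D : Rn n -> Rn n -> R -> R -> Prop)
    (I : 'I_n -> Rn n -> Rn n -> R) (hhat ghat : Rn n -> R -> R -> R) : Prop :=
  commuting_on D I /\
  exists htilde : Rn n -> R -> R,
    forall p q y x, D p q y x ->
      hhat (fun i => I i p q) y x
      = htilde (fun i => I i p q) (ghat (fun i => I i p q) y x).

Definition i0 : 'I_3 := @Ordinal 3 0 isT.
Definition i1 : 'I_3 := @Ordinal 3 1 isT.
Definition i2 : 'I_3 := @Ordinal 3 2 isT.

(* p = (R1, Lambda2, Theta), q = (r1, l2, theta), (y, x) = (G2, g2); the remaining
   coordinates Z, G, z, g do not occur in the functions considered. *)
Definition I_K (i : 'I_3) (p q : Rn 3) : R :=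
  if i == i0 then q i0 else if i == i1 then p i1 else p i2.

Definition D_K (m2 M2 : R) (p q : Rn 3) (y x : R) : Prop :=
  K_domain m2 M2 (q i0) (p i1) (p i2) y x.

(* [f] as a function of I = (r1, Lambda2, Theta). *)
Definition hat (f : R -> R -> R -> R -> R -> R) (v : Rn 3) (y x : R) : R :=
  f (v i0) (v i1) (v i2) y x.

(* Main.v *)
Require Import Defs.
From mathcomp Require Import all_boot.
From Stdlib Require Import Reals Lra ClassicalEpsilon FunctionalExtensionality.
From Coquelicot Require Import Coquelicot.
Open Scope R_scope.

(** After scaling the semi-major axis to 1, put the two attracting points of the
two-centre problem at the focus [0] of the ellipse and at [x1], and write [rho]
and [delta] for the distances from the point of eccentric anomaly [z] to them.
The elliptic coordinates [x = (rho +- delta) / r] of that point, with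
[r = |x1|], satisfy [rho = r (x_+ + x_-) / 2], so that the averaged potential
[int rho / delta dz] is half [r] times the sum of the integrals of [x_+] and
[x_-] against [dz / delta].

What makes this useful is that fixing one elliptic coordinate [x] gives an
equation [A cos z + B sin z = K] which is linear in [(cos z, sin z)], because the
terms in [rho ^ 2] cancel; here [A], [B], [K] are polynomials in [x].  Hence:
- along the ellipse, [(2 delta x') ^ 2 = A ^ 2 + B ^ 2 - K ^ 2]
  ([slope_sqr]), and this discriminant is a quartic polynomial in [x] that
  depends on [r], [Theta / Lambda2] and [E0 / Lambda2 ^ 2] only ([pot_linear]);
- since [x_+ >= 1 >= x_-], a value [x > 1] (resp. [x < 1]) is taken by [x_+]
  (resp. [x_-]) exactly when the quartic is non-negative at [x]
  ([pot_ycoord_ge0], [ycoord_onto]), so that the range of each coordinate is the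
  same for all ellipses with these three data;
- a zero of the quartic is taken at one angle only, unless the coordinate is
  constant ([turning_point]), so that each coordinate goes once up and once down
  during a revolution ([ycoord_oscillates]).

On a monotone branch one may substitute [x] for [z], and the integral of [F(x)]
against [dz / delta] becomes that of [2 F / sqrt quartic] over the range
([rise_transfer]).  It follows that the integrals of [x_+], of [x_-] and of 1
are functions of the three data ([kepler_average_invariant]).  A coordinate which
is constant gives no information on the integral of 1, but then the other one
is not constant, because [rho] is not.

The argument is global: no connectedness of the level sets of [E0] is used.
The formula for [h2] itself is vector geometry, together with the substitution
of the eccentric anomaly for the mean anomaly. *)

(** * Transfer of integrals between monotone branches *)

(** The derivative of an elliptic coordinate vanishes at the ends of its monotone
branches, so the mean value has to be found strictly inside. *)
Lemma mvt_open (f df : R -> R) (a b : R) :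
  a < b -> (forall x, continuous f x) ->
  (forall x, a < x < b -> is_derive f x (df x)) ->
  exists c, a < c < b /\ f b - f a = df c * (b - a).
Proof.
move=> ab cf df_.
have pr1 : forall c, a < c < b -> derivable_pt f c.
  move=> c hc; exists (df c); exact/is_derive_Reals/df_.
have pr2 : forall c, a < c < b -> derivable_pt id c.
  move=> c hc; exact: derivable_pt_id.
have c1 : forall c, a <= c <= b -> continuity_pt f c.
  move=> c _; exact/continuity_pt_filterlim/cf.
have c2 : forall c, a <= c <= b -> continuity_pt id c.
  move=> c _; exact/derivable_continuous_pt/derivable_pt_id.
case: (MVT f id a b pr1 pr2 ab c1 c2) => c [hc E].
exists c; split => //.
have Ef : derive_pt f c (pr1 c hc) = df c.
  apply: derive_pt_eq_0; exact/is_derive_Reals/df_.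
have Ei : derive_pt id c (pr2 c hc) = 1.
  apply: derive_pt_eq_0; exact: derivable_pt_lim_id.
move: E; rewrite Ef Ei /id; lra.
Qed.

Lemma mem_Rmin_Rmax (a b x : R) :
  a <= b -> Rmin a b <= x <= Rmax a b -> a <= x <= b.
Proof. by move=> ab; rewrite Rmin_left // Rmax_right. Qed.

Lemma ivt (f : R -> R) (a b y : R) :
  (forall x, continuous f x) -> a <= b ->
  f a <= y <= f b \/ f b <= y <= f a -> exists x, a <= x <= b /\ f x = y.
Proof.
move=> cf ab hy.
have cf' : continuity f by move=> x; exact/continuity_pt_filterlim/cf.
have hy' : Rmin (f a) (f b) <= y <= Rmax (f a) (f b).
  case: hy => hy; [rewrite Rmin_left ?Rmax_right | rewrite Rmin_right ?Rmax_left]; lra.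
case: (IVT_gen f a b y cf' hy') => x [hx E].
exists x; split => //; exact: mem_Rmin_Rmax.
Qed.

Lemma ex_RInt_cont (f : R -> R) (a b : R) :
  (forall x, continuous f x) -> ex_RInt f a b.
Proof. by move=> cf; apply: (@ex_RInt_continuous R_CompleteNormedModule) => z _. Qed.

Lemma RInt_chasles (f : R -> R) (a b c : R) :
  (forall x, continuous f x) -> RInt f a b + RInt f b c = RInt f a c.
Proof. by move=> cf; apply: RInt_Chasles; apply: ex_RInt_cont. Qed.

Lemma RInt_sub_le (f : R -> R) (a b c d : R) :
  (forall x, continuous f x) -> (forall x, 0 <= f x) ->
  a <= c -> c <= d -> d <= b -> RInt f c d <= RInt f a b.
Proof.
move=> cf pf ac cd db.
rewrite -(RInt_chasles f a c b) // -(RInt_chasles f c d b) //.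
have h1 : 0 <= RInt f a c by apply: RInt_ge_0 => // ; exact: ex_RInt_cont.
have h2 : 0 <= RInt f d b by apply: RInt_ge_0 => // ; exact: ex_RInt_cont.
lra.
Qed.

(** After the substitution of [f] the integrand [F / sqrt P] is singular at the end
points; passing to the limit in a bound on compact subintervals avoids improper
integrals. *)
Lemma RInt_exhaust (f : R -> R) (a b m : R) :
  a < b -> (forall x, continuous f x) ->
  (forall u v, a < u -> u < v -> v < b -> RInt f u v <= m) -> RInt f a b <= m.
Proof.
move=> ab cf H.
case: (continuity_ab_maj (fun x => Rabs (f x)) a b) => [|c _|xM [hM _]]; first lra.
  apply/continuity_pt_filterlim; apply: (continuous_comp f Rabs) => //.
  exact: continuous_Rabs.
set B := Rabs (f xM) in hM.
have B0 : 0 <= B by exact: Rabs_pos.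
(* A bound of |f| makes the two end pieces of length d negligible. *)
have key : forall u v, a <= u -> u <= v -> v <= b -> RInt f u v <= B * (v - u).
  move=> u v au uv vb.
  have := abs_RInt_le_const f u v B uv (ex_RInt_cont f u v cf).
  have hB : forall t, u <= t <= v -> Rabs (f t) <= B by move=> t ht; apply: hM; lra.
  move/(_ hB) => h; have := Rle_abs (RInt f u v); lra.
apply: le_epsilon => eps e0.
set d := Rmin ((b - a) / 4) (eps / (2 * (B + 1))).
have d0 : 0 < d.
  apply: Rmin_pos; first lra.
  by apply: Rdiv_lt_0_compat; lra.
have d1 : d <= (b - a) / 4 by exact: Rmin_l.
have d2 : 2 * (B * d) <= eps.
  have : d <= eps / (2 * (B + 1)) by exact: Rmin_r.
  move/(Rmult_le_compat_l (2 * (B + 1))) => h.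
  have {}h := h ltac:(lra).
  have E : 2 * (B + 1) * (eps / (2 * (B + 1))) = eps by field; lra.
  nra.
rewrite -(RInt_chasles f a (a + d) b) // -(RInt_chasles f (a + d) (b - d) b) //.
have := key a (a + d) ltac:(lra) ltac:(lra) ltac:(lra).
have := key (b - d) b ltac:(lra) ltac:(lra) ltac:(lra).
have := H (a + d) (b - d) ltac:(lra) ltac:(lra) ltac:(lra).
lra.
Qed.

(** An increasing solution of [f' = w sqrt (P f)], where [w] is the density of the
time that makes the equation autonomous.  Nothing is asked at [a] and [b], which
will be turning points, where [P f] vanishes. *)
Definition rise (P f w : R -> R) (a b : R) : Prop :=
  a < b /\ (forall x, continuous f x) /\
  (forall x, 0 < w x /\ continuous w x) /\
  (forall x, a < x < b -> 0 < P (f x) /\ is_derive f x (w x * sqrt (P (f x)))).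

Lemma rise_lt (P f w : R -> R) (a b u v : R) :
  rise P f w a b -> a <= u -> u < v -> v <= b -> f u < f v.
Proof.
move=> [ab [cf [hw hd]]] au uv vb.
have [c [hc E]] : exists c, u < c < v /\ f v - f u = (w c * sqrt (P (f c))) * (v - u).
  apply: (mvt_open f (fun x => w x * sqrt (P (f x)))) => // x hx.
  by apply hd; lra.
have [P0 _] := hd c ltac:(lra).
have [w0 _] := hw c.
have s0 := sqrt_lt_R0 _ P0.
have := Rmult_lt_0_compat _ _ w0 s0; nra.
Qed.

(** Two branches can be compared through the right-hand side, which has lost [w]
and the parametrization. *)
Lemma rise_RInt (P F f w : R -> R) (a b u v : R) :
  (forall c, continuous P c) -> (forall c, continuous F c) ->
  rise P f w a b -> a < u -> u < v -> v < b ->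
  RInt (fun x => F (f x) * w x) u v = RInt (fun c => F c / sqrt (P c)) (f u) (f v).
Proof.
move=> cP cF [ab [cf [hw hd]]] au uv vb.
rewrite -(RInt_comp (fun c => F c / sqrt (P c)) f (fun x => w x * sqrt (P (f x))) u v).
- apply: RInt_ext => x; rewrite Rmin_left ?Rmax_right; try lra.
  move=> hx; have [P0 _] := hd x ltac:(lra).
  have s0 := sqrt_lt_R0 _ P0.
  rewrite /scal /= /mult /=; field; lra.
- move=> x /mem_Rmin_Rmax hx; have [P0 _] := hd x ltac:(lra).
  have s0 := sqrt_lt_R0 _ P0.
  apply: (continuous_mult F (fun c => / sqrt (P c))) => //.
  apply: (continuous_comp (fun c => sqrt (P c)) Rinv).
    by apply: (continuous_comp P sqrt) => //; exact: continuous_sqrt.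
  by apply: continuous_Rinv; lra.
- move=> x /mem_Rmin_Rmax hx; have [P0 dx] := hd x ltac:(lra); split => //.
  apply: (continuous_mult w (fun c => sqrt (P (f c)))); first by apply hw.
  apply: (continuous_comp (fun c => P (f c)) sqrt); last exact: continuous_sqrt.
  exact: (continuous_comp f P).
Qed.

(** Each compact piece of the first branch has a counterpart in the second one,
by the intermediate value theorem, and both have the same integral; as [F >= 0],
the piece is bounded by the whole second branch. *)
Lemma rise_transfer_le (P F f w f' w' : R -> R) (a b a' b' : R) :
  (forall c, continuous P c) -> (forall c, continuous F c) ->
  (forall x, 0 <= F (f' x)) ->
  rise P f w a b -> rise P f' w' a' b' -> f a = f' a' -> f b = f' b' ->
  RInt (fun x => F (f x) * w x) a b <= RInt (fun x => F (f' x) * w' x) a' b'.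
Proof.
move=> cP cF F0 r r' Ea Eb.
have [ab [cf [hw hd]]] := r; have [ab' [cf' [hw' hd']]] := r'.
apply: RInt_exhaust => //.
  move=> x; apply: (continuous_mult (fun x => F (f x)) w); last by apply hw.
  exact: (continuous_comp f F).
move=> u v au uv vb.
have fa : f a < f u by apply: (rise_lt _ _ _ _ _ _ _ r); lra.
have fuv : f u < f v by apply: (rise_lt _ _ _ _ _ _ _ r); lra.
have fb : f v < f b by apply: (rise_lt _ _ _ _ _ _ _ r); lra.
have [u' [hu' Eu]] : exists u', a' <= u' <= b' /\ f' u' = f u.
  by apply: ivt => //; lra.
have [v' [hv' Ev]] : exists v', u' <= v' <= b' /\ f' v' = f v.
  by apply: ivt => //; lra.
have au' : a' < u' by case: (Rle_lt_or_eq_dec a' u') => // [|E]; [lra|subst u'; lra].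
have uv' : u' < v' by case: (Rle_lt_or_eq_dec u' v') => // [|E]; [lra|subst v'; lra].
have vb' : v' < b' by case: (Rle_lt_or_eq_dec v' b') => // [|E]; [lra|subst v'; lra].
rewrite (rise_RInt _ _ _ _ _ _ _ _ cP cF r) // -Eu -Ev.
rewrite -(rise_RInt _ _ _ _ _ _ _ _ cP cF r') //.
apply: RInt_sub_le; try lra.
  move=> x; apply: (continuous_mult (fun x => F (f' x)) w'); last by apply hw'.
  exact: (continuous_comp f' F).
move=> x; apply: Rmult_le_pos => //; have := proj1 (hw' x); lra.
Qed.

Lemma rise_transfer (P F f w f' w' : R -> R) (a b a' b' : R) :
  (forall c, continuous P c) -> (forall c, continuous F c) ->
  (forall x, 0 <= F (f x)) -> (forall x, 0 <= F (f' x)) ->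
  rise P f w a b -> rise P f' w' a' b' -> f a = f' a' -> f b = f' b' ->
  RInt (fun x => F (f x) * w x) a b = RInt (fun x => F (f' x) * w' x) a' b'.
Proof.
move=> cP cF F0 F0' r r' Ea Eb.
by apply: Rle_antisym; apply: (rise_transfer_le P).
Qed.

(** * Elliptic coordinates of the points of an ellipse *)

(** An ellipse of semi-axis 1 with one focus at the origin, together with a point
[x1]: [dst] is [|x1|], and with [P], [Q] the orthonormal directions of the
perihelion and of the motion there, [x1 . P = - dst * pc] and
[sqrt (1 - ecc ^ 2) * (x1 . Q) = dst * qc].  These are the parameters in which the
squared distance is polynomial. *)
Record config := Config { dst : R; ecc : R; pc : R; qc : R }.

Definition rho (d : config) (z : R) : R := 1 - ecc d * cos z.

Definition dsq (d : config) (z : R) : R :=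
  dst d ^ 2 + 2 * dst d * (pc d * (cos z - ecc d) - qc d * sin z) + rho d z ^ 2.

(** The value of [Theta ^ 2 / Lambda2 ^ 2]; see [norm_Theta2_config_K]. *)
Definition norm_Theta2 (d : config) : R := (1 - ecc d ^ 2) * (1 - pc d ^ 2) - qc d ^ 2.

(** The value of [E0 / Lambda2 ^ 2]; see [E0_config_K]. *)
Definition norm_E0 (d : config) : R := 1 - ecc d ^ 2 + dst d * (ecc d * pc d).

Definition quartic (r t e x : R) : R :=
  4 * x ^ 2 - 4 * t - 4 * e * (x ^ 2 - 1) - (r * x ^ 2 - 2 * x - r) ^ 2.

(** The third condition says that the projection of [x1] to the plane of the
ellipse is at most as long as [x1]; the last one that [x1] is off the ellipse. *)
Definition admissible (d : config) : Prop :=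
  0 < dst d /\ 0 < ecc d < 1 /\ 0 <= norm_Theta2 d /\ (forall z, 0 < dsq d z).

Definition delta (d : config) (z : R) : R := sqrt (dsq d z).

(** For [sg = 1] and [sg = -1], the distance to 1 of the elliptic coordinates
[(rho + delta) / dst >= 1] and [(rho - delta) / dst <= 1].  Measuring from 1
treats both coordinates alike: each is [1 + sg * ycoord] with [ycoord >= 0]. *)
Definition ycoord (d : config) (sg z : R) : R :=
  (delta d z + sg * (rho d z - dst d)) / dst d.

Definition Acoef (d : config) (x : R) : R := 2 * (pc d - x * ecc d).
Definition Bcoef (d : config) : R := - 2 * qc d.
Definition Kcoef (d : config) (x : R) : R :=
  dst d * x ^ 2 - 2 * x - dst d + 2 * pc d * ecc d.

(** The equation of the points of the ellipse whose elliptic coordinate is [x];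
it comes from squaring [delta = +- (dst * x - rho)]. *)
Definition Lrel (d : config) (x z : R) : R :=
  Acoef d x * cos z + Bcoef d * sin z - Kcoef d x.

Definition pot (d : config) (sg c : R) : R :=
  quartic (dst d) (norm_Theta2 d) (norm_E0 d) (1 + sg * c).

Lemma cos2_sin2 (z : R) : cos z ^ 2 + sin z ^ 2 = 1.
Proof. have := sin2_cos2 z; rewrite /Rsqr; nra. Qed.

(** The representative in [[0, 2 PI]] is what brings a global extremum back into
a window of one period. *)
Lemma angle_of (u v : R) :
  u ^ 2 + v ^ 2 = 1 -> exists z, 0 <= z <= 2 * PI /\ cos z = u /\ sin z = v.
Proof.
move=> h.
have hu : -1 <= u <= 1 by nra.
have hp := acos_bound u.
have E : Rabs v = sqrt (1 - u ^ 2).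
  by rewrite -sqrt_Rsqr_abs /Rsqr; congr sqrt; lra.
have Ec : cos (acos u) = u by apply: cos_acos; lra.
have Es : sin (acos u) = sqrt (1 - u ^ 2).
  rewrite sin_acos; last lra.
  by rewrite /Rsqr /= Rmult_1_r.
case: (Rle_lt_dec 0 v) => hv.
  exists (acos u); split; first lra.
  by rewrite Ec Es -E Rabs_pos_eq.
exists (2 * PI - acos u); split; first lra.
rewrite cos_minus sin_minus cos_2PI sin_2PI Ec Es -E Rabs_left //.
by split; ring.
Qed.

Lemma angle_mod (z : R) :
  exists z', 0 <= z' <= 2 * PI /\ cos z' = cos z /\ sin z' = sin z.
Proof. exact/angle_of/cos2_sin2. Qed.

(** This is how [E0] enters: the condition that the equation [Lrel] be solvable in
[z] involves the configuration through three numbers only. *)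
Lemma pot_linear (d : config) (sg c : R) :
  Acoef d (1 + sg * c) ^ 2 + Bcoef d ^ 2 - Kcoef d (1 + sg * c) ^ 2 = pot d sg c.
Proof. by rewrite /Acoef /Bcoef /Kcoef /pot /quartic /norm_Theta2 /norm_E0; ring. Qed.

Lemma delta_gt0 (d : config) (z : R) : admissible d -> 0 < delta d z.
Proof. move=> [_ [_ [_ h]]]; exact: sqrt_lt_R0. Qed.

Lemma delta_sqr (d : config) (z : R) : admissible d -> delta d z ^ 2 = dsq d z.
Proof. move=> [_ [_ [_ h]]]; apply: pow2_sqrt; exact: Rlt_le. Qed.

(** As a polynomial in the elliptic coordinate, the equation of degree 2 has the two
coordinates of the point [z] as its roots. *)
Lemma Lrel_factor (d : config) (sg c z : R) :
  admissible d -> sg ^ 2 = 1 ->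
  Lrel d (1 + sg * c) z =
  - dst d * (c - ycoord d sg z) * (c + ycoord d (- sg) z).
Proof.
move=> hd hsg; have r0 := proj1 hd.
have E : - dst d * (c - ycoord d sg z) * (c + ycoord d (- sg) z) =
  (delta d z ^ 2 - (dst d * c - sg * (rho d z - dst d)) ^ 2) / dst d.
  by rewrite /ycoord; field; lra.
rewrite E (delta_sqr d z hd).
have -> : (dst d * c - sg * (rho d z - dst d)) ^ 2 =
   dst d ^ 2 * c ^ 2 - 2 * dst d * c * sg * (rho d z - dst d)
   + sg ^ 2 * (rho d z - dst d) ^ 2 by ring.
rewrite hsg /Lrel /Acoef /Bcoef /Kcoef.
have -> : dst d * (1 + sg * c) ^ 2 = dst d * (1 + 2 * sg * c + sg ^ 2 * c ^ 2) by ring.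
by rewrite hsg /dsq /rho; field; lra.
Qed.

Lemma sqr_le_between (a b : R) : 0 <= b -> a ^ 2 <= b ^ 2 -> - b <= a <= b.
Proof. by move=> b0 h; split; nra. Qed.

Lemma sqr1_cases (s : R) : s ^ 2 = 1 -> s = 1 \/ s = -1.
Proof. by move=> h; case: (Rle_lt_dec 0 s) => ?; [left|right]; nra. Qed.

(** Cauchy-Schwarz: the left-hand side is the square of the component along [x1]
of the position on the ellipse, and [rho] is the length of the latter. *)
Lemma focal_bound (d : config) (z : R) :
  admissible d ->
  (pc d * (cos z - ecc d) - qc d * sin z) ^ 2 <= rho d z ^ 2.
Proof.
move=> [r0 [e01 [t0 _]]].
have cs := cos2_sin2 z.
set u := cos z - ecc d; set v := sin z.
have Er : rho d z ^ 2 = u ^ 2 + (1 - ecc d ^ 2) * v ^ 2.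
  by rewrite /rho /u /v; nra.
have h0 : 0 < 1 - ecc d ^ 2 by nra.
rewrite Er; move: t0; rewrite /norm_Theta2; set k := 1 - ecc d ^ 2 in h0 *.
move=> t0; apply: (Rmult_le_reg_l k) => //.
have : k * (u ^ 2 + k * v ^ 2) - k * (pc d * u - qc d * v) ^ 2
  = (k * pc d * v + qc d * u) ^ 2
    + (k * (1 - pc d ^ 2) - qc d ^ 2) * (u ^ 2 + k * v ^ 2) by ring.
have h1 : 0 <= u ^ 2 + k * v ^ 2.
  by have := pow2_ge_0 u; have := pow2_ge_0 v; nra.
have := pow2_ge_0 (k * pc d * v + qc d * u).
have := Rmult_le_pos _ _ t0 h1.
lra.
Qed.

Lemma rho_gt0 (d : config) (z : R) : admissible d -> 0 < rho d z.
Proof.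
move=> [_ [e01 _]]; rewrite /rho; have := COS_bound z; nra.
Qed.

(** The triangle inequality for the two foci and the point of the ellipse. *)
Lemma ycoord_ge0 (d : config) (sg z : R) :
  admissible d -> sg ^ 2 = 1 -> 0 <= ycoord d sg z.
Proof.
move=> hd hsg; have r0 := proj1 hd; have p0 := rho_gt0 d z hd.
have t0 := delta_gt0 d z hd; have hb := focal_bound d z hd.
have E := delta_sqr d z hd.
have hb' := sqr_le_between _ _ (Rlt_le _ _ p0) hb.
have h : (rho d z - dst d) ^ 2 <= delta d z ^ 2 by rewrite E /dsq; nra.
have h2 := sqr_le_between _ _ (Rlt_le _ _ t0) h.
apply: Rmult_le_pos; last by apply/Rlt_le/Rinv_0_lt_compat.
by have [->|->] := sqr1_cases sg hsg; lra.
Qed.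

Lemma ycoord_ext (d : config) (sg z z' : R) :
  cos z = cos z' -> sin z = sin z' -> ycoord d sg z = ycoord d sg z'.
Proof. by move=> c s; rewrite /ycoord /delta /dsq /rho c s. Qed.

Lemma cos_2PI_shift (z : R) : cos (z + 2 * PI) = cos z.
Proof. by rewrite cos_plus cos_2PI sin_2PI; ring. Qed.

Lemma sin_2PI_shift (z : R) : sin (z + 2 * PI) = sin z.
Proof. by rewrite sin_plus cos_2PI sin_2PI; ring. Qed.

Lemma delta_periodic (d : config) (z : R) : delta d (z + 2 * PI) = delta d z.
Proof. by rewrite /delta /dsq /rho cos_2PI_shift sin_2PI_shift. Qed.

Lemma ycoord_periodic (d : config) (sg z : R) :
  ycoord d sg (z + 2 * PI) = ycoord d sg z.
Proof. by apply: ycoord_ext; rewrite ?cos_2PI_shift ?sin_2PI_shift. Qed.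

Lemma ycoord_Lrel (d : config) (sg z : R) :
  admissible d -> sg ^ 2 = 1 -> Lrel d (1 + sg * ycoord d sg z) z = 0.
Proof. by move=> hd hsg; rewrite Lrel_factor //; ring. Qed.

(** Implicit differentiation of [Lrel]: with respect to the coordinate the
derivative of [Lrel] is [- 2 sg delta]. *)
Definition slope (d : config) (sg z : R) : R :=
  (- Acoef d (1 + sg * ycoord d sg z) * sin z + Bcoef d * cos z) / (2 * delta d z).

Lemma is_derive_delta (d : config) (z : R) :
  admissible d ->
  is_derive (delta d) z
    ((2 * dst d * (- pc d * sin z - qc d * cos z) + 2 * rho d z * (ecc d * sin z))
     / (2 * delta d z)).
Proof.
move=> hd; apply: (is_derive_sqrt (dsq d)); last exact: (proj2 (proj2 (proj2 hd))).
by rewrite /dsq /rho; auto_derive => //; ring.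
Qed.

Lemma is_derive_ycoord (d : config) (sg z : R) :
  admissible d -> sg ^ 2 = 1 -> is_derive (ycoord d sg) z (slope d sg z).
Proof.
move=> hd hsg; have t0 := delta_gt0 d z hd; have r0 := proj1 hd.
have -> : slope d sg z =
  ((2 * dst d * (- pc d * sin z - qc d * cos z) + 2 * rho d z * (ecc d * sin z))
     / (2 * delta d z) + sg * (ecc d * sin z)) / dst d.
  rewrite /slope /Acoef /Bcoef /ycoord.
  have -> : sg * ((delta d z + sg * (rho d z - dst d)) / dst d) =
     (sg * delta d z + sg ^ 2 * (rho d z - dst d)) / dst d by field; lra.
  by rewrite hsg; field; lra.
rewrite /ycoord /Rdiv [X in is_derive _ _ X]Rmult_comm.
apply: (is_derive_ext (fun t => / dst d * (delta d t + sg * (rho d t - dst d)))).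
  by move=> t; rewrite Rmult_comm.
apply: is_derive_scal; apply: (is_derive_plus (delta d)).
  exact: is_derive_delta.
by rewrite /rho; auto_derive => //; ring.
Qed.

Lemma continuous_delta (d : config) (z : R) : admissible d -> continuous (delta d) z.
Proof.
by move=> hd; apply: ex_derive_continuous; eexists; exact: is_derive_delta.
Qed.

Lemma continuous_ycoord (d : config) (sg z : R) :
  admissible d -> sg ^ 2 = 1 -> continuous (ycoord d sg) z.
Proof.
by move=> hd hsg; apply: ex_derive_continuous; eexists; exact: is_derive_ycoord.
Qed.

(** [(- A sin z + B cos z) ^ 2 + (A cos z + B sin z) ^ 2 = A ^ 2 + B ^ 2], and the
second term is [K ^ 2] on the ellipse. *)
Lemma slope_sqr (d : config) (sg z : R) :
  admissible d -> sg ^ 2 = 1 ->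
  (2 * delta d z * slope d sg z) ^ 2 = pot d sg (ycoord d sg z).
Proof.
move=> hd hsg; have t0 := delta_gt0 d z hd.
rewrite -pot_linear // /slope.
have := ycoord_Lrel d sg z hd hsg; rewrite /Lrel.
set A := Acoef _ _; set B := Bcoef _; set K := Kcoef _ _ => hL.
have -> : K = A * cos z + B * sin z by lra.
have cs := cos2_sin2 z.
transitivity ((- A * sin z + B * cos z) ^ 2); first by field; lra.
transitivity ((A ^ 2 + B ^ 2) * (cos z ^ 2 + sin z ^ 2) - (A * cos z + B * sin z) ^ 2).
  by ring.
by rewrite cs; ring.
Qed.

Lemma pot_ycoord_ge0 (d : config) (sg z : R) :
  admissible d -> sg ^ 2 = 1 -> 0 <= pot d sg (ycoord d sg z).
Proof. by move=> hd hsg; rewrite -slope_sqr //; exact: pow2_ge_0. Qed.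

Lemma linear_trig_solvable (A B K : R) :
  0 <= A ^ 2 + B ^ 2 - K ^ 2 -> exists z, A * cos z + B * sin z = K.
Proof.
move=> h; set N := A ^ 2 + B ^ 2.
have [N0|N0] : 0 < N \/ N = 0.
  by case: (Rle_lt_or_eq_dec 0 N) => [|?|?]; [rewrite /N; nra|left|right].
- set S := sqrt (N - K ^ 2).
  have S2 : S ^ 2 = N - K ^ 2 by exact: pow2_sqrt.
  have [|z [_ [c s]]] := angle_of ((A * K - B * S) / N) ((B * K + A * S) / N).
    transitivity ((A ^ 2 + B ^ 2) * (K ^ 2 + S ^ 2) / N ^ 2); first by field; lra.
    by rewrite S2 -/N; field; lra.
  exists z; rewrite c s.
  transitivity ((A ^ 2 + B ^ 2) * K / N); first by field; lra.
  by rewrite -/N; field; lra.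
- exists 0; rewrite /N in N0 h; have := pow2_ge_0 A; have := pow2_ge_0 B.
  have := pow2_ge_0 K => *.
  have -> : A = 0 by nra.
  have -> : B = 0 by nra.
  have -> : K = 0 by nra.
  by ring.
Qed.

(** Where the quartic is non-negative the linear equation has a solution [z], and
one of the two coordinates of the point [z] is the prescribed one; the sign of
[c] tells which. *)
Lemma ycoord_onto (d : config) (sg c : R) :
  admissible d -> sg ^ 2 = 1 -> 0 < c -> 0 <= pot d sg c ->
  exists z, ycoord d sg z = c.
Proof.
move=> hd hsg c0; rewrite -pot_linear // => /linear_trig_solvable [z hz].
exists z; have : Lrel d (1 + sg * c) z = 0 by rewrite /Lrel hz; ring.
have hsg' : (- sg) ^ 2 = 1 by rewrite -hsg; ring.
rewrite Lrel_factor // => /Rmult_integral [/Rmult_integral [|] | ].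
- by have := proj1 hd; lra.
- by lra.
- by have := ycoord_ge0 d (- sg) z hd hsg'; lra.
Qed.

(** Hence neither coordinate is identically 1.  Values equal to 1 escape [ycoord_onto],
and this lets them be reached as limits of others. *)
Lemma Lrel_1_nontrivial (d : config) :
  admissible d -> ~ (forall z, Lrel d 1 z = 0).
Proof.
move=> hd L; have := L 0; have := L PI; have := L (PI / 2).
rewrite /Lrel cos_0 sin_0 cos_PI sin_PI cos_PI2 sin_PI2 /Acoef /Bcoef /Kcoef.
have [_ [e01 _]] := hd.
move=> h1 h2 h3.
(* Comparing z = 0 and z = PI gives A = 0, and then K <> 0. *)
have Ep : pc d = ecc d by lra.
rewrite Ep in h1 h2 h3; nra.
Qed.

Lemma ycoord_not_const0 (d : config) (sg : R) :
  admissible d -> sg ^ 2 = 1 -> exists z, 0 < ycoord d sg z.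
Proof.
move=> hd hsg; apply: NNPP => H; apply: (Lrel_1_nontrivial d hd) => z.
have y0 : ycoord d sg z = 0.
  apply: Rle_antisym; last exact: ycoord_ge0.
  by apply: Rnot_lt_le => h; apply: H; exists z.
by have := ycoord_Lrel d sg z hd hsg; rewrite y0 Rmult_0_r Rplus_0_r.
Qed.

(** At a double solution the equation reads [K (cos (z - z0) - 1) = 0], and its left
side has the sign of [- K] away from [z0]; by [Lrel_factor] this sign tells on
which side of [c] the coordinate lies. *)
Lemma turning_point (d : config) (sg z0 : R) :
  admissible d -> sg ^ 2 = 1 -> pot d sg (ycoord d sg z0) = 0 ->
  (forall z, ycoord d sg z = ycoord d sg z0) \/
  (forall z, cos (z - z0) <> 1 -> ycoord d sg z < ycoord d sg z0) \/
  (forall z, cos (z - z0) <> 1 -> ycoord d sg z0 < ycoord d sg z).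
Proof.
move=> hd hsg; have r0 := proj1 hd; set c := ycoord d sg z0.
rewrite -pot_linear // => h0.
have := ycoord_Lrel d sg z0 hd hsg; rewrite /Lrel -/c => L0.
have hsg' : (- sg) ^ 2 = 1 by rewrite -hsg; ring.
have c0 : 0 <= c by exact: ycoord_ge0.
have F z := Lrel_factor d sg c z hd hsg.
have N : c = 0 -> ~ (forall z, Lrel d (1 + sg * c) z = 0).
  by move=> ->; rewrite Rmult_0_r Rplus_0_r; exact: Lrel_1_nontrivial.
move: F N L0 h0; rewrite /Lrel.
set A := Acoef _ _; set B := Bcoef _; set K := Kcoef _ _ => F N L0 h0.
have cs := cos2_sin2 z0.
(* Equality holds in Cauchy-Schwarz, so (A, B) = K (cos z0, sin z0). *)
have E1 : (A * sin z0 - B * cos z0) ^ 2 = 0.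
  have -> : (A * sin z0 - B * cos z0) ^ 2 =
    (A ^ 2 + B ^ 2) * (cos z0 ^ 2 + sin z0 ^ 2) - (A * cos z0 + B * sin z0) ^ 2 by ring.
  have -> : A * cos z0 + B * sin z0 = K by lra.
  by rewrite cs; lra.
have E2 : A * sin z0 - B * cos z0 = 0 by nra.
have EA : A = K * cos z0.
  transitivity (A * (cos z0 ^ 2 + sin z0 ^ 2)); first by rewrite cs; ring.
  have -> : K = A * cos z0 + B * sin z0 by lra.
  have -> : A * (cos z0 ^ 2 + sin z0 ^ 2) =
     (A * cos z0 + B * sin z0) * cos z0 + (A * sin z0 - B * cos z0) * sin z0 by ring.
  by rewrite E2; ring.
have EB : B = K * sin z0.
  transitivity (B * (cos z0 ^ 2 + sin z0 ^ 2)); first by rewrite cs; ring.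
  have -> : K = A * cos z0 + B * sin z0 by lra.
  have -> : B * (cos z0 ^ 2 + sin z0 ^ 2) =
     (A * cos z0 + B * sin z0) * sin z0 - (A * sin z0 - B * cos z0) * cos z0 by ring.
  by rewrite E2; ring.
have G z : dst d * ((c - ycoord d sg z) * (c + ycoord d (- sg) z)) = K * (1 - cos (z - z0)).
  rewrite cos_minus; have := F z; rewrite EA EB; lra.
have S z : 0 <= c + ycoord d (- sg) z.
  by have := ycoord_ge0 d (- sg) z hd hsg'; lra.
have C z : cos (z - z0) <> 1 -> 0 < 1 - cos (z - z0).
  by move=> h; have := COS_bound (z - z0); lra.
case: (Rtotal_order K 0) => [Kn|[K0|Kp]].
- right; right => z /C cz.
  apply: Rnot_le_lt => h.
  have := G z; have := Rmult_le_pos _ _ (Rlt_le _ _ r0) (Rmult_le_pos (c - ycoord d sg z) _ ltac:(lra) (S z)).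
  nra.
- have {}c0 : 0 < c.
    case: (Rle_lt_or_eq_dec 0 c c0) => // E; case: (N (esym E)) => z.
    by rewrite EA EB K0; ring.
  left => z.
  have := G z; rewrite K0 Rmult_0_l => /Rmult_integral [|/Rmult_integral [|]]; [lra|lra|].
  by have := ycoord_ge0 d (- sg) z hd hsg'; lra.
- right; left => z /C cz.
  apply: Rnot_le_lt => h.
  have := G z; have := Rmult_le_pos _ _ (Rlt_le _ _ r0) (Rmult_le_pos (ycoord d sg z - c) _ ltac:(lra) (S z)).
  nra.
Qed.

(** * Oscillation of the elliptic coordinates *)

Lemma RInt_periodic (f : R -> R) (T a : R) :
  (forall x, continuous f x) -> (forall x, f (x + T) = f x) ->
  RInt f a (a + T) = RInt f 0 T.
Proof.
move=> cf pf.
have E : RInt f T (a + T) = RInt f 0 a.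
  have h := RInt_comp_lin f 1 T 0 a.
  rewrite Rmult_0_r Rplus_0_l Rmult_1_l in h.
  rewrite -h; last exact: ex_RInt_cont.
  apply: RInt_ext => x _; rewrite Rmult_1_l pf /scal /= /mult /=; ring.
have := RInt_chasles f a 0 (a + T) cf; have := RInt_chasles f 0 T (a + T) cf.
have := RInt_chasles f 0 a 0 cf; rewrite RInt_point /zero /= E; lra.
Qed.

Lemma RInt_opp_arg (f : R -> R) (a b : R) :
  (forall x, continuous f x) -> RInt f a b = RInt (fun x => f (- x)) (- b) (- a).
Proof.
move=> cf.
have h := RInt_comp_lin f (- 1) 0 (- b) (- a).
rewrite !Rplus_0_r in h.
have := h (ex_RInt_cont _ _ _ cf).
have -> : -1 * - b = b by ring.
have -> : -1 * - a = a by ring.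
have := RInt_chasles f a b a cf; rewrite RInt_point /zero /= => E1 E2.
have -> : RInt f a b = - RInt f b a by lra.
rewrite -E2.
have -> : RInt (fun y => scal (-1) (f (-1 * y + 0))) (- b) (- a) =
          RInt (fun y => scal (-1) (f (- y))) (- b) (- a).
  by apply: RInt_ext => x _; congr (scal _ (f _)); ring.
rewrite (RInt_scal (fun y => f (- y))).
  by rewrite /scal /= /mult /=; ring.
apply: ex_RInt_cont => x; apply: (continuous_comp Ropp f) => //.
exact: (continuous_opp id x (continuous_id x)).
Qed.

Lemma sign_of_derive (f df : R -> R) (a b : R) :
  a < b -> (forall x, is_derive f x (df x)) -> (forall x, continuous df x) ->
  (forall x, a < x < b -> df x <> 0) -> f a < f b ->
  forall x, a < x < b -> 0 < df x.
Proof.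
move=> ab hd cdf nz fab x hx.
have cf : forall y, continuous f y.
  by move=> y; apply: ex_derive_continuous; exists (df y).
have [c [hc E]] := mvt_open f df a b ab cf (fun y _ => hd y).
have c0 : 0 < df c by nra.
apply: Rnot_le_lt => h.
have [y [hy Ey]] : exists y, Rmin x c <= y <= Rmax x c /\ df y = 0.
  apply: ivt => //; first exact: Rminmax.
  rewrite /Rmin /Rmax; case: Rle_dec => _; lra.
apply: (nz y) => //; split.
  by apply: Rlt_le_trans (proj1 hy); apply: Rmin_glb_lt; lra.
by apply: Rle_lt_trans (proj2 hy) _; apply: Rmax_lub_lt; lra.
Qed.

(** The factor 2 turns [slope_sqr] into the equation in [rise]. *)
Definition weight (d : config) (z : R) : R := / (2 * delta d z).

Lemma weight_gt0 (d : config) (z : R) : admissible d -> 0 < weight d z.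
Proof. by move=> hd; apply: Rinv_0_lt_compat; have := delta_gt0 d z hd; lra. Qed.

Lemma continuous_weight (d : config) (z : R) : admissible d -> continuous (weight d) z.
Proof.
move=> hd; apply: (continuous_comp (fun z => 2 * delta d z) Rinv).
  by apply: (continuous_scal_r 2 (delta d)); exact: continuous_delta.
by apply: continuous_Rinv; have := delta_gt0 d z hd; lra.
Qed.

Lemma weight_periodic (d : config) (z : R) : weight d (z + 2 * PI) = weight d z.
Proof. by rewrite /weight delta_periodic. Qed.

Lemma continuous_slope (d : config) (sg z : R) :
  admissible d -> sg ^ 2 = 1 -> continuous (slope d sg) z.
Proof.
move=> hd hsg; apply: ex_derive_continuous.
have t0 := delta_gt0 d z hd.
have h1 : ex_derive (delta d) z by eexists; exact: is_derive_delta.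
have h2 : ex_derive (ycoord d sg) z by eexists; exact: is_derive_ycoord.
rewrite /slope /Acoef; auto_derive; repeat split => //; lra.
Qed.

Lemma ycoord_extrema (d : config) (sg : R) :
  admissible d -> sg ^ 2 = 1 ->
  exists zm zM, zm <= zM <= zm + 2 * PI /\
    (forall z, ycoord d sg zm <= ycoord d sg z <= ycoord d sg zM).
Proof.
move=> hd hsg; have P0 := PI_RGT_0.
have cy z : continuity_pt (ycoord d sg) z.
  exact/continuity_pt_filterlim/continuous_ycoord.
have [zm [hm zmI]] := continuity_ab_min (ycoord d sg) 0 (2 * PI) ltac:(lra) (fun z _ => cy z).
have [zM [hM zMI]] := continuity_ab_maj (ycoord d sg) zm (zm + 2 * PI) ltac:(lra) (fun z _ => cy z).
exists zm, zM; split => // z.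
have [z' [z'I [c s]]] := angle_mod z.
rewrite -(ycoord_ext d sg _ _ c s); split; first exact: hm.
case: (Rle_lt_dec zm z') => h; first by apply: hM; lra.
by rewrite -ycoord_periodic; apply: hM; lra.
Qed.

Lemma cos_ne1 (x : R) : - (2 * PI) < x < 2 * PI -> x <> 0 -> cos x <> 1.
Proof.
move=> hx nz E.
have s : sin (x / 2) = 0.
  have := cos_2a_sin (x / 2); have -> : 2 * (x / 2) = x by field.
  by rewrite E; nra.
have P0 := PI_RGT_0.
case: (Rlt_or_le 0 x) => h.
  by have := sin_gt_0 (x / 2) ltac:(lra) ltac:(lra); lra.
by have := sin_gt_0 (- (x / 2)) ltac:(lra) ltac:(lra); rewrite sin_neg; lra.
Qed.

(** Between a minimum and the neighbouring maxima the quartic cannot vanish, by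
[turning_point], so the slope keeps its sign.  The descending branch is traversed
backwards, by [z |-> - z], to become a rise as well. *)
Lemma ycoord_oscillates (d : config) (sg : R) :
  admissible d -> sg ^ 2 = 1 ->
  (forall z, ycoord d sg z = ycoord d sg 0) \/
  exists zm zM, zm < zM < zm + 2 * PI /\
    (forall z, ycoord d sg zm <= ycoord d sg z <= ycoord d sg zM) /\
    rise (pot d sg) (ycoord d sg) (weight d) zm zM /\
    rise (pot d sg) (fun z => ycoord d sg (- z)) (fun z => weight d (- z))
         (- (zm + 2 * PI)) (- zM).
Proof.
move=> hd hsg; have P0 := PI_RGT_0.
have [zm [zM [hI hmM]]] := ycoord_extrema d sg hd hsg.
case: (Req_dec (ycoord d sg zm) (ycoord d sg zM)) => E.
  by left => z; have := hmM z; have := hmM 0; lra.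
right; exists zm, zM.
have lt : ycoord d sg zm < ycoord d sg zM by have := hmM zm; lra.
have zlt : zm < zM < zm + 2 * PI.
  split; apply: Rnot_le_lt => h.
    have e : zM = zm by lra.
    by rewrite e in lt; lra.
  have e : zM = zm + 2 * PI by lra.
  by rewrite e ycoord_periodic in lt; lra.
have pos z : (zm < z < zM \/ zM < z < zm + 2 * PI) -> 0 < pot d sg (ycoord d sg z).
  move=> hz; apply: Rnot_le_lt => h.
  have pz : pot d sg (ycoord d sg z) = 0.
    by have := pot_ycoord_ge0 d sg z hd hsg; lra.
  (* A zero at z would make the coordinate constant, or z its only maximum or
     its only minimum; but zM and zm differ from z modulo 2 PI. *)
  have n1 : cos (zm - z) <> 1 by apply: cos_ne1; lra.
  have n2 : cos (zM - z) <> 1 by apply: cos_ne1; lra.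
  case: (turning_point d sg z hd hsg pz) => [c|[c|c]].
  - by rewrite (c zm) (c zM) in E.
  - by have := c _ n2; have := hmM z; lra.
  - by have := c _ n1; have := hmM z; lra.
have nz z : (zm < z < zM \/ zM < z < zm + 2 * PI) -> slope d sg z <> 0.
  move=> hz e; have := pos z hz; rewrite -slope_sqr // e; nra.
have root z : 0 <= slope d sg z -> slope d sg z = weight d z * sqrt (pot d sg (ycoord d sg z)).
  move=> h; have t0 := delta_gt0 d z hd.
  rewrite -slope_sqr // sqrt_pow2; last nra.
  by rewrite /weight; field; lra.
have rootn z : slope d sg z <= 0 -> - slope d sg z = weight d z * sqrt (pot d sg (ycoord d sg z)).
  move=> h; have t0 := delta_gt0 d z hd.
  have -> : pot d sg (ycoord d sg z) = (2 * delta d z * - slope d sg z) ^ 2.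
    by rewrite -slope_sqr //; ring.
  rewrite sqrt_pow2; last nra.
  by rewrite /weight; field; lra.
split => //; split => //; split.
- split; first lra; split; first by move=> x; exact: continuous_ycoord.
  split; first by move=> x; split; [exact: weight_gt0|exact: continuous_weight].
  move=> x hx; split; first by apply: pos; left.
  rewrite -root; first exact: is_derive_ycoord.
  apply/Rlt_le/(sign_of_derive (ycoord d sg) (slope d sg) zm zM) => //; first lra.
  + by move=> y; exact: is_derive_ycoord.
  + by move=> y; exact: continuous_slope.
  + by move=> y hy; apply: nz; left.
- have copp x : continuous Ropp x by exact: (continuous_opp id x (continuous_id x)).
  have dopp x : is_derive (fun z => ycoord d sg (- z)) x (- slope d sg (- x)).
    have := is_derive_comp (ycoord d sg) Ropp x (slope d sg (- x)) (- 1).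
    rewrite /scal /= /mult /=; have -> : -1 * slope d sg (- x) = - slope d sg (- x) by ring.
    by apply; [exact: is_derive_ycoord|auto_derive].
  split; first lra; split.
    by move=> x; apply: (continuous_comp Ropp) => //; exact: continuous_ycoord.
  split.
    move=> x; split; first exact: weight_gt0.
    by apply: (continuous_comp Ropp) => //; exact: continuous_weight.
  move=> x hx; split; first by apply: pos; lra.
  rewrite -rootn //.
  have : 0 < - slope d sg (- x); last by lra.
  apply: (sign_of_derive (fun z => ycoord d sg (- z)) (fun z => - slope d sg (- z))
             (- (zm + 2 * PI)) (- zM)) => //; first lra.
  + move=> y; apply: (continuous_opp (fun z => slope d sg (- z))).
    by apply: (continuous_comp Ropp) => //; exact: continuous_slope.
  + by move=> y hy e; apply: (nz (- y)); lra.
  + by rewrite !Ropp_involutive ycoord_periodic.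
Qed.

(** * Dependence on the three invariants only *)

Definition same_invariants (d d' : config) : Prop :=
  dst d = dst d' /\ norm_Theta2 d = norm_Theta2 d' /\ norm_E0 d = norm_E0 d'.

Lemma same_invariants_sym (d d' : config) :
  same_invariants d d' -> same_invariants d' d.
Proof. by rewrite /same_invariants => -[-> [-> ->]]. Qed.

Lemma same_pot (d d' : config) (sg c : R) :
  same_invariants d d' -> pot d sg c = pot d' sg c.
Proof. by move=> [h1 [h2 h3]]; rewrite /pot h1 h2 h3. Qed.

Lemma ycoord_range (d d' : config) (sg z : R) :
  admissible d -> admissible d' -> sg ^ 2 = 1 -> same_invariants d d' ->
  0 < ycoord d sg z -> exists z', ycoord d' sg z' = ycoord d sg z.
Proof.
move=> hd hd' hsg hs y0; apply: ycoord_onto => //.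
by rewrite -(same_pot d) //; exact: pot_ycoord_ge0.
Qed.

Lemma ycoord_max_le (d d' : config) (sg zM zM' : R) :
  admissible d -> admissible d' -> sg ^ 2 = 1 -> same_invariants d d' ->
  (forall z, ycoord d sg z <= ycoord d sg zM) ->
  (forall z, ycoord d' sg z <= ycoord d' sg zM') ->
  ycoord d sg zM <= ycoord d' sg zM'.
Proof.
move=> hd hd' hsg hs hM hM'.
have [z0 hz0] := ycoord_not_const0 d sg hd hsg.
have [|z' <-] := ycoord_range d d' sg zM hd hd' hsg hs; last exact: hM'.
by have := hM z0; lra.
Qed.

(** When the minimum of the first coordinate is 0, [ycoord_range] does not apply to
it, but does to the positive values close to it. *)
Lemma ycoord_min_le (d d' : config) (sg zm zm' : R) :
  admissible d -> admissible d' -> sg ^ 2 = 1 -> same_invariants d d' ->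
  (forall z, ycoord d sg zm <= ycoord d sg z) ->
  (forall z, ycoord d' sg zm' <= ycoord d' sg z) ->
  ycoord d' sg zm' <= ycoord d sg zm.
Proof.
move=> hd hd' hsg hs hm hm'.
apply: Rnot_lt_le => h.
have [z0 hz0] : exists z, 0 < ycoord d sg z /\ ycoord d sg z < ycoord d' sg zm'.
  have [z1 hz1] := ycoord_not_const0 d sg hd hsg.
  have m0 := ycoord_ge0 d sg zm hd hsg.
  case: (Rlt_or_le (ycoord d sg z1) (ycoord d' sg zm')) => h1; first by exists z1.
  set c := (ycoord d sg zm + ycoord d' sg zm') / 2.
  have hc : ycoord d sg zm < c < ycoord d' sg zm' by rewrite /c; lra.
  have cy x : continuous (ycoord d sg) x by exact: continuous_ycoord.
  have [z [_ Ez]] : exists z, Rmin zm z1 <= z <= Rmax zm z1 /\ ycoord d sg z = c.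
    apply: ivt => //; first exact: Rminmax.
    by rewrite /Rmin /Rmax; case: Rle_dec => _; lra.
  by exists z; rewrite Ez; lra.
have [z' E] := ycoord_range d d' sg z0 hd hd' hsg hs (proj1 hz0).
by have := hm' z'; rewrite E; lra.
Qed.

Lemma ycoord_same_min (d d' : config) (sg zm zm' : R) :
  admissible d -> admissible d' -> sg ^ 2 = 1 -> same_invariants d d' ->
  (forall z, ycoord d sg zm <= ycoord d sg z) ->
  (forall z, ycoord d' sg zm' <= ycoord d' sg z) ->
  ycoord d sg zm = ycoord d' sg zm'.
Proof.
move=> hd hd' hsg hs hm hm'; have hs' := same_invariants_sym _ _ hs.
by apply: Rle_antisym; [apply: (ycoord_min_le d' d)|apply: (ycoord_min_le d d')].
Qed.

Lemma ycoord_same_max (d d' : config) (sg zM zM' : R) :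
  admissible d -> admissible d' -> sg ^ 2 = 1 -> same_invariants d d' ->
  (forall z, ycoord d sg z <= ycoord d sg zM) ->
  (forall z, ycoord d' sg z <= ycoord d' sg zM') ->
  ycoord d sg zM = ycoord d' sg zM'.
Proof.
move=> hd hd' hsg hs hM hM'; have hs' := same_invariants_sym _ _ hs.
by apply: Rle_antisym; [apply: (ycoord_max_le d d')|apply: (ycoord_max_le d' d)].
Qed.

Lemma continuous_pot (d : config) (sg c : R) : continuous (pot d sg) c.
Proof.
by apply: ex_derive_continuous; rewrite /pot /quartic; auto_derive.
Qed.

(** The first alternative occurs when the range reduces to a point, for both
configurations at once. *)
Lemma ycoord_same_RInt (d d' : config) (sg : R) (F : R -> R) :
  admissible d -> admissible d' -> sg ^ 2 = 1 -> same_invariants d d' ->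
  (forall c, continuous F c) -> (forall c, 0 <= c -> 0 <= F c) ->
  (forall z, ycoord d sg z = ycoord d sg 0 /\ ycoord d' sg z = ycoord d sg 0) \/
  RInt (fun z => F (ycoord d sg z) * weight d z) 0 (2 * PI) =
  RInt (fun z => F (ycoord d' sg z) * weight d' z) 0 (2 * PI).
Proof.
move=> hd hd' hsg hs cF F0.
have cint e (he : admissible e) x :
    continuous (fun z => F (ycoord e sg z) * weight e z) x.
  apply: (continuous_mult (fun z => F (ycoord e sg z)) (weight e)).
    by apply: (continuous_comp (ycoord e sg) F) => //; exact: continuous_ycoord.
  exact: continuous_weight.
have pint e x : F (ycoord e sg (x + 2 * PI)) * weight e (x + 2 * PI) =
    F (ycoord e sg x) * weight e x by rewrite ycoord_periodic weight_periodic.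
have split2 e (he : admissible e) zm zM :
    RInt (fun z => F (ycoord e sg z) * weight e z) 0 (2 * PI) =
    RInt (fun z => F (ycoord e sg z) * weight e z) zm zM +
    RInt (fun z => F (ycoord e sg (- z)) * weight e (- z)) (- (zm + 2 * PI)) (- zM).
  rewrite -(RInt_periodic _ _ zm (cint e he) (pint e)).
  rewrite -(RInt_chasles _ zm zM _ (cint e he)); congr (_ + _).
  exact: (RInt_opp_arg (fun z => F (ycoord e sg z) * weight e z) _ _ (cint e he)).
have [c|[zm [zM [I [hmM [r1 r2]]]]]] := ycoord_oscillates d sg hd hsg;
have [c'|[zm' [zM' [I' [hmM' [r1' r2']]]]]] := ycoord_oscillates d' sg hd' hsg.
- left => z; split; first exact: c.
  rewrite c'; apply: esym; apply: (ycoord_same_min d d') => // x.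
    by rewrite c; exact: Rle_refl.
  by rewrite c'; exact: Rle_refl.
- exfalso; have := rise_lt _ _ _ _ _ _ _ r1' (Rle_refl _) (proj1 r1') (Rle_refl _).
  have cc z : ycoord d sg 0 <= ycoord d sg z by rewrite c; exact: Rle_refl.
  have cc' z : ycoord d sg z <= ycoord d sg 0 by rewrite c; exact: Rle_refl.
  have := ycoord_same_min d d' sg 0 zm' hd hd' hsg hs cc (fun z => proj1 (hmM' z)).
  have := ycoord_same_max d d' sg 0 zM' hd hd' hsg hs cc' (fun z => proj2 (hmM' z)).
  lra.
- exfalso; have := rise_lt _ _ _ _ _ _ _ r1 (Rle_refl _) (proj1 r1) (Rle_refl _).
  have cc z : ycoord d' sg 0 <= ycoord d' sg z by rewrite c'; exact: Rle_refl.
  have cc' z : ycoord d' sg z <= ycoord d' sg 0 by rewrite c'; exact: Rle_refl.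
  have := ycoord_same_min d d' sg zm 0 hd hd' hsg hs (fun z => proj1 (hmM z)) cc.
  have := ycoord_same_max d d' sg zM 0 hd hd' hsg hs (fun z => proj2 (hmM z)) cc'.
  lra.
- right.
  have Em : ycoord d sg zm = ycoord d' sg zm'.
    by apply: ycoord_same_min => // z; [apply hmM|apply hmM'].
  have EM : ycoord d sg zM = ycoord d' sg zM'.
    by apply: ycoord_same_max => // z; [apply hmM|apply hmM'].
  have Fy e (he : admissible e) x : 0 <= F (ycoord e sg x).
    by apply: F0; exact: ycoord_ge0.
  have Ep : pot d sg = pot d' sg.
    by apply: functional_extensionality => c; exact: same_pot.
  rewrite -Ep in r1' r2'.
  have cp := continuous_pot d sg.
  rewrite (split2 d hd zm zM) (split2 d' hd' zm' zM'); congr (_ + _).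
    by apply: (rise_transfer (pot d sg)) => // x; apply: Fy.
  apply: (rise_transfer (pot d sg) F (fun z => ycoord d sg (- z)) _
           (fun z => ycoord d' sg (- z))) => //; try (by move=> x; exact: Fy).
    by rewrite !Ropp_involutive !ycoord_periodic.
  by rewrite !Ropp_involutive.
Qed.

(** The mean of the inverse distance, up to [2 PI]: [rho dz] is the differential of
the mean anomaly. *)
Definition kepler_average (d : config) : R :=
  RInt (fun z => rho d z / delta d z) 0 (2 * PI).

Lemma rho_ycoord (d : config) (z : R) :
  admissible d -> rho d z = dst d * (2 + ycoord d 1 z - ycoord d (-1) z) / 2.
Proof. by move=> [r0 _]; rewrite /ycoord; field; lra. Qed.

Lemma kepler_average_split (d : config) :
  admissible d ->
  kepler_average d =
    2 * dst d * RInt (weight d) 0 (2 * PI)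
    + dst d * RInt (fun z => ycoord d 1 z * weight d z) 0 (2 * PI)
    - dst d * RInt (fun z => ycoord d (-1) z * weight d z) 0 (2 * PI).
Proof.
move=> hd.
have cw := fun x => continuous_weight d x hd.
have s1 : 1 ^ 2 = 1 by ring.
have s2 : (-1) ^ 2 = 1 by ring.
have cy sg (h : sg ^ 2 = 1) x : continuous (fun z => ycoord d sg z * weight d z) x.
  by apply: (continuous_mult (ycoord d sg) (weight d)) => //; exact: continuous_ycoord.
have iw := ex_RInt_cont (weight d) 0 (2 * PI) cw.
have i1 := ex_RInt_cont _ 0 (2 * PI) (cy 1 s1).
have i2 := ex_RInt_cont _ 0 (2 * PI) (cy (-1) s2).
apply: is_RInt_unique.
apply: (is_RInt_ext (fun z => minus (plus (scal (2 * dst d) (weight d z))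
    (scal (dst d) (ycoord d 1 z * weight d z)))
    (scal (dst d) (ycoord d (-1) z * weight d z)))).
  move=> z _; rewrite /minus /plus /opp /scal /= /mult /=.
  rewrite {1}rho_ycoord // /weight; have := delta_gt0 d z hd => ?; field; lra.
apply: (is_RInt_minus (V := R_NormedModule)).
  apply: (is_RInt_plus (V := R_NormedModule)).
  - by apply: (is_RInt_scal (V := R_NormedModule)); exact: RInt_correct.
  - by apply: (is_RInt_scal (V := R_NormedModule)); exact: RInt_correct.
by apply: (is_RInt_scal (V := R_NormedModule)); exact: RInt_correct.
Qed.

Lemma kepler_average_invariant (d d' : config) :
  admissible d -> admissible d' -> same_invariants d d' ->
  kepler_average d = kepler_average d'.
Proof.
move=> hd hd' hs.
have s1 : 1 ^ 2 = 1 by ring.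
have s2 : (-1) ^ 2 = 1 by ring.
have cc1 (c : R) : continuous (fun _ : R => 1) c by exact: continuous_const.
have ci (c : R) : continuous (fun x : R => x) c by exact: continuous_id.
have ET : RInt (weight d) 0 (2 * PI) = RInt (weight d') 0 (2 * PI).
  have unit e : RInt (weight e) 0 (2 * PI) =
      RInt (fun z => 1 * weight e z) 0 (2 * PI).
    by apply: RInt_ext => x _; rewrite Rmult_1_l.
  rewrite !unit.
  have [c1|//] := ycoord_same_RInt d d' 1 (fun _ => 1) hd hd' s1 hs cc1 (fun _ _ => Rle_0_1).
  have [c2|//] := ycoord_same_RInt d d' (-1) (fun _ => 1) hd hd' s2 hs cc1 (fun _ _ => Rle_0_1).
  exfalso.
  (* Both coordinates, hence rho, would be constant. *)
  have rc : rho d 0 = rho d PI.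
    by rewrite !rho_ycoord // (proj1 (c1 PI)) (proj1 (c2 PI)).
  by move: rc; rewrite /rho cos_0 cos_PI; have := hd => -[_ [e01 _]]; lra.
have Ey sg (h : sg ^ 2 = 1) : RInt (fun z => ycoord d sg z * weight d z) 0 (2 * PI)
    = RInt (fun z => ycoord d' sg z * weight d' z) 0 (2 * PI).
  have [c|//] := ycoord_same_RInt d d' sg (fun x => x) hd hd' h hs ci (fun _ h => h).
  have pull e (he : admissible e) : (forall z, ycoord e sg z = ycoord d sg 0) ->
     RInt (fun z => ycoord e sg z * weight e z) 0 (2 * PI) =
     ycoord d sg 0 * RInt (weight e) 0 (2 * PI).
    move=> ce; transitivity (RInt (fun z => scal (ycoord d sg 0) (weight e z)) 0 (2 * PI)).
      by apply: RInt_ext => x _; rewrite ce.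
    apply: (RInt_scal (weight e)); apply: ex_RInt_cont => x; exact: continuous_weight.
  by rewrite !pull // ?ET // => z; apply c.
by rewrite !kepler_average_split // ET !Ey // (proj1 hs).
Qed.

(** * The averaged potential and the first integral in reduced coordinates *)

Definition config_K (m2 M2 r1 L T G g : R) : config :=
  let s := sqrt (1 - T ^ 2 / G ^ 2) in
  Config (r1 / a2K m2 M2 L) (sqrt (1 - G ^ 2 / L ^ 2))
         (s * cos g) (s * (G / L) * sin g).

Section KCoordinates.

Context (m2 M2 : R) (hm2 : 0 < m2) (hM2 : 0 < M2).

Lemma a2K_gt0 (L : R) : 0 < L -> 0 < a2K m2 M2 L.
Proof.
move=> L0; rewrite /a2K; apply: Rdiv_lt_0_compat; first exact: pow_lt.
by apply: Rmult_lt_0_compat => //; exact: pow_lt.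
Qed.

Lemma K_domain_bounds (r1 L T G g : R) :
  K_domain m2 M2 r1 L T G g ->
  0 < r1 /\ 0 < G /\ 0 < L /\ 0 < 1 - T ^ 2 / G ^ 2 /\ 0 < 1 - G ^ 2 / L ^ 2 < 1.
Proof.
move=> [r0 [TG [GL _]]].
have G0 : 0 < G by have := Rabs_pos T; lra.
have L0 : 0 < L by lra.
have T2 : T ^ 2 < G ^ 2.
  by have [? ?] := Rabs_def2 _ _ TG; nra.
have q1 : T ^ 2 / G ^ 2 < 1.
  by apply/(Rdiv_lt_1 _ (G ^ 2)); [exact: pow_lt|].
have q2 : G ^ 2 / L ^ 2 < 1.
  by apply/(Rdiv_lt_1 _ (L ^ 2)); [exact: pow_lt|nra].
have q3 : 0 < G ^ 2 / L ^ 2 by apply: Rdiv_lt_0_compat; nra.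
lra.
Qed.

Lemma dist2K_dsq (r1 L T G g z : R) :
  0 < L -> 
  dist2K m2 M2 r1 L T G g z =
  a2K m2 M2 L ^ 2 * dsq (config_K m2 M2 r1 L T G g) z.
Proof.
move=> L0; have a0 := a2K_gt0 L L0.
by rewrite /dist2K /dsq /config_K /rho /rho2 /=; field; lra.
Qed.

Lemma norm_Theta2_config_K (r1 L T G g : R) :
  K_domain m2 M2 r1 L T G g -> norm_Theta2 (config_K m2 M2 r1 L T G g) = T ^ 2 / L ^ 2.
Proof.
move=> /K_domain_bounds [_ [G0 [L0 [s0 e0]]]].
have cs := cos2_sin2 g.
rewrite /norm_Theta2 /config_K /=.
have S2 := pow2_sqrt _ (Rlt_le _ _ s0).
have E2 := pow2_sqrt _ (Rlt_le _ _ (proj1 e0)).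
move: S2 E2; set S := sqrt _; set E := sqrt _ => S2 E2.
have -> : (1 - E * (E * 1)) = G ^ 2 / L ^ 2 by move: E2 => /= ->; lra.
transitivity (G ^ 2 / L ^ 2 * (1 - S ^ 2 * (cos g ^ 2 + sin g ^ 2))).
  by field; lra.
by rewrite cs S2; field; lra.
Qed.

Lemma config_K_admissible (r1 L T G g : R) :
  K_domain m2 M2 r1 L T G g -> admissible (config_K m2 M2 r1 L T G g).
Proof.
move=> h; have [r0 [G0 [L0 [s0 e0]]]] := K_domain_bounds _ _ _ _ _ h.
have a0 := a2K_gt0 L L0; split; first by apply: Rdiv_lt_0_compat.
split.
  rewrite -[ecc _]/(sqrt (1 - G ^ 2 / L ^ 2)); split; first exact: (sqrt_lt_R0 _ (proj1 e0)).
  rewrite -[X in _ < X]sqrt_1; apply: sqrt_lt_1_alt; lra.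
split.
  rewrite norm_Theta2_config_K //; apply: Rmult_le_pos; first exact: pow2_ge_0.
  by apply/Rlt_le/Rinv_0_lt_compat/pow_lt.
move=> z; have [_ [_ [_ /(_ z)]]] := h; rewrite dist2K_dsq //.
by move=> D0; have := pow_lt _ 2 a0; nra.
Qed.

Lemma E0_config_K (r1 L T G g : R) :
  K_domain m2 M2 r1 L T G g ->
  E0 m2 M2 r1 L T G g = L ^ 2 * norm_E0 (config_K m2 M2 r1 L T G g).
Proof.
move=> /K_domain_bounds [_ [G0 [L0 [s0 e0]]]].
have E2 := pow2_sqrt _ (Rlt_le _ _ (proj1 e0)).
rewrite /E0 /norm_E0 -[ecc _]/(sqrt (1 - G ^ 2 / L ^ 2)) E2.
rewrite -[dst _]/(r1 / a2K m2 M2 L) -[pc _]/(sqrt (1 - T ^ 2 / G ^ 2) * cos g) /a2K.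
by field; repeat split; lra.
Qed.

Lemma h2K_kepler_average (r1 L T G g : R) :
  K_domain m2 M2 r1 L T G g ->
  h2K m2 M2 r1 L T G g =
  / (2 * PI) * (/ a2K m2 M2 L * kepler_average (config_K m2 M2 r1 L T G g)).
Proof.
move=> h; have [r0 [G0 [L0 [s0 e0]]]] := K_domain_bounds _ _ _ _ _ h.
have a0 := a2K_gt0 L L0; have hd := config_K_admissible _ _ _ _ _ h.
rewrite /h2K; congr (_ * _).
set d := config_K _ _ _ _ _ _ _ in hd *.
transitivity (RInt (fun z => scal (/ a2K m2 M2 L) (rho d z / delta d z)) 0 (2 * PI)).
  apply: RInt_ext => z _; rewrite dist2K_dsq // -/d sqrt_mult_alt; last exact: pow2_ge_0.
  rewrite sqrt_pow2; last lra.
  rewrite /scal /= /mult /= -/(delta d z); have := delta_gt0 d z hd => d0.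
  have -> : rho2 L G z = rho d z by [].
  by field; lra.
apply: (RInt_scal (fun z => rho d z / delta d z)); apply: ex_RInt_cont => z.
apply: ex_derive_continuous; have d0 := delta_gt0 d z hd.
have h1 : ex_derive (delta d) z by eexists; exact: is_derive_delta.
by rewrite /rho; auto_derive; repeat split => //; lra.
Qed.

Lemma h2K_invariant (r1 L T G g G' g' : R) :
  K_domain m2 M2 r1 L T G g -> K_domain m2 M2 r1 L T G' g' ->
  E0 m2 M2 r1 L T G g = E0 m2 M2 r1 L T G' g' ->
  h2K m2 M2 r1 L T G g = h2K m2 M2 r1 L T G' g'.
Proof.
move=> h h' E; rewrite !h2K_kepler_average //; congr (_ * (_ * _)).
have L0 : 0 < L by have := K_domain_bounds _ _ _ _ _ h; tauto.
apply: kepler_average_invariant; try exact: config_K_admissible.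
split => //; split; first by rewrite !norm_Theta2_config_K.
by move: E; rewrite !E0_config_K // => /Rmult_eq_reg_l; apply; apply/Rgt_not_eq/pow_lt.
Qed.

(** A function that is constant on the fibres of a map factors through it. *)
Lemma h2K_factors :
  exists htilde2 : R -> R -> R -> R -> R,
    forall r1 L T G g : R, K_domain m2 M2 r1 L T G g ->
      h2K m2 M2 r1 L T G g = htilde2 r1 L T (E0 m2 M2 r1 L T G g).
Proof.
exists (fun r1 L T E => epsilon (inhabits 0) (fun h => exists G g,
  K_domain m2 M2 r1 L T G g /\ E0 m2 M2 r1 L T G g = E /\ h2K m2 M2 r1 L T G g = h)).
move=> r1 L T G g h.
set Q := fun h => _.
have [|G' [g' [h' [E <-]]]] := epsilon_spec (inhabits 0) Q.
  by exists (h2K m2 M2 r1 L T G g), G, g.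
by apply: h2K_invariant.
Qed.

End KCoordinates.

Lemma I_K_q_independent (i k : 'I_3) (p q : Defs.Rn 3) (t : R) :
  k != i0 -> I_K i p (upd q k t) = I_K i p q.
Proof. by move=> hk; rewrite /I_K /upd [i0 == k]eq_sym (negbTE hk). Qed.

Lemma I_K_p0_independent (i : 'I_3) (p q : Defs.Rn 3) (t : R) :
  I_K i (upd p i0 t) q = I_K i p q.
Proof. by rewrite /I_K /upd. Qed.

Lemma I_K_has_partials (i : 'I_3) (p q : Defs.Rn 3) : has_partials (I_K i) p q.
Proof.
have dupd (v : Defs.Rn 3) (k l : 'I_3) x : ex_derive (fun t => upd v k t l) x.
  by rewrite /upd; case: (l == k); [exact: ex_derive_id|exact: ex_derive_const].
by move=> k; rewrite /I_K; split; case: (i == i0) => //; case: (i == i1) => //;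
  exact: ex_derive_const.
Qed.

(** Of [(r1, Lambda2, Theta)] only [r1] is a position, and its conjugate momentum
is not among them. *)
Lemma I_K_commute (i j : 'I_3) (p q : Defs.Rn 3) : poisson (I_K i) (I_K j) p q = 0.
Proof.
rewrite /poisson; apply: (big_ind (fun x : R => x = 0)) => // [x y -> ->|k _].
  exact: Rplus_0_l.
case: (boolP (k == i0)) => [/eqP ->|hk].
  have E l : Derive (fun t => I_K l (upd p i0 t) q) (p i0) = 0.
    rewrite (Derive_ext _ (fun _ => I_K l p q)); first exact: Derive_const.
    by move=> t; exact: I_K_p0_independent.
  by rewrite !E; ring.
have E l : Derive (fun t => I_K l p (upd q k t)) (q k) = 0.
  rewrite (Derive_ext _ (fun _ => I_K l p q)); first exact: Derive_const.
  by move=> t; exact: I_K_q_independent.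
by rewrite !E; ring.
Qed.

(** * Kepler's equation and vector geometry of the ellipse *)

Lemma mean_anomaly_lip (e z z' : R) :
  0 <= e < 1 -> z <= z' ->
  (1 - e) * (z' - z) <= mean_anomaly_of e z' - mean_anomaly_of e z.
Proof.
move=> he; rewrite /mean_anomaly_of; case/Rle_lt_or_eq_dec => [h|->]; last by lra.
have dm x : is_derive (fun z => z - e * sin z) x (1 - e * cos x).
  by auto_derive => //; ring.
have cm x : continuous (fun z => z - e * sin z) x.
  by apply: ex_derive_continuous; eexists; exact: dm.
have [c [_ ->]] := mvt_open _ _ z z' h cm (fun x _ => dm x).
apply: Rmult_le_compat_r; first lra.
by have := COS_bound c; nra.
Qed.

Lemma mean_anomaly_inj (e z z' : R) :
  0 <= e < 1 -> mean_anomaly_of e z = mean_anomaly_of e z' -> z = z'.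
Proof.
move=> he E; case: (Rle_lt_dec z z') => h.
  by have := mean_anomaly_lip e z z' he h; rewrite E; nra.
by have := mean_anomaly_lip e z' z he (Rlt_le _ _ h); rewrite E; nra.
Qed.

Lemma eccentric_anomalyK (e l : R) :
  0 <= e < 1 -> mean_anomaly_of e (eccentric_anomaly e l) = l.
Proof.
move=> he; apply: (epsilon_spec (inhabits 0) (fun z => mean_anomaly_of e z = l)).
have cm x : continuous (mean_anomaly_of e) x.
  by apply: ex_derive_continuous; rewrite /mean_anomaly_of; auto_derive.
have [|z [_ h]] := ivt (mean_anomaly_of e) (l - 1) (l + 1) l cm ltac:(lra).
  left; rewrite /mean_anomaly_of; have := SIN_bound (l - 1); have := SIN_bound (l + 1); nra.
by exists z.
Qed.

Lemma mean_anomalyK (e z : R) :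
  0 <= e < 1 -> eccentric_anomaly e (mean_anomaly_of e z) = z.
Proof. by move=> he; apply: (mean_anomaly_inj e) => //; exact: eccentric_anomalyK. Qed.

(** By [mean_anomaly_lip], the inverse is Lipschitz with constant
[1 / (1 - e)]. *)
Lemma continuous_eccentric_anomaly (e l : R) :
  0 <= e < 1 -> continuous (eccentric_anomaly e) l.
Proof.
move=> he; apply/filterlim_locally => eps0.
have d0 : 0 < eps0 * (1 - e) by have := cond_pos eps0; nra.
exists (mkposreal _ d0) => l'.
rewrite /ball /= /AbsRing_ball /abs /minus /plus /opp /= => h.
have E1 := eccentric_anomalyK e l he; have E2 := eccentric_anomalyK e l' he.
move: h E1 E2; set z := eccentric_anomaly e l; set z' := eccentric_anomaly e l'.
move=> /Rabs_def2 h E1 E2; apply: Rabs_def1.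
  case: (Rle_lt_dec z z') => hz; last by have := cond_pos eps0; lra.
  by have := mean_anomaly_lip e z z' he hz; nra.
case: (Rle_lt_dec z' z) => hz; last by have := cond_pos eps0; lra.
by have := mean_anomaly_lip e z' z he hz; nra.
Qed.

Lemma RInt_mean_anomaly (e : R) (f : R -> R) :
  0 <= e < 1 -> (forall z, continuous f z) ->
  RInt (fun l => f (eccentric_anomaly e l)) 0 (2 * PI) =
  RInt (fun z => (1 - e * cos z) * f z) 0 (2 * PI).
Proof.
move=> he cf.
have h := RInt_comp (fun l => f (eccentric_anomaly e l)) (mean_anomaly_of e)
   (fun z => 1 - e * cos z) 0 (2 * PI).
have E0 : mean_anomaly_of e 0 = 0 by rewrite /mean_anomaly_of sin_0; ring.
have E1 : mean_anomaly_of e (2 * PI) = 2 * PI by rewrite /mean_anomaly_of sin_2PI; ring.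
rewrite E0 E1 in h; rewrite -h.
- by apply: RInt_ext => z _; rewrite mean_anomalyK.
- move=> z _; apply: (continuous_comp (eccentric_anomaly e) f) => //.
  exact: continuous_eccentric_anomaly.
- move=> z _; split; first by rewrite /mean_anomaly_of; auto_derive => //; ring.
  by apply: ex_derive_continuous; auto_derive.
Qed.

Lemma vdot_comm (u v : vec3) : vdot u v = vdot v u.
Proof. by case: u => [[? ?] ?]; case: v => [[? ?] ?]; rewrite /=; ring. Qed.

Lemma vdot_add_r (u v w : vec3) : vdot u (vadd v w) = vdot u v + vdot u w.
Proof.
by case: u => [[? ?] ?]; case: v => [[? ?] ?]; case: w => [[? ?] ?]; rewrite /=; ring.
Qed.

Lemma vdot_scale_r (c : R) (u v : vec3) : vdot u (vscale c v) = c * vdot u v.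
Proof. by case: u => [[? ?] ?]; case: v => [[? ?] ?]; rewrite /=; ring. Qed.

Lemma vdot_add_l (u v w : vec3) : vdot (vadd v w) u = vdot v u + vdot w u.
Proof. by rewrite vdot_comm vdot_add_r !(vdot_comm u). Qed.

Lemma vdot_scale_l (c : R) (u v : vec3) : vdot (vscale c u) v = c * vdot u v.
Proof. by rewrite vdot_comm vdot_scale_r vdot_comm. Qed.

Lemma vdot_sub_self (u v : vec3) :
  vdot (vsub u v) (vsub u v) = vdot u u - 2 * vdot u v + vdot v v.
Proof. by case: u => [[? ?] ?]; case: v => [[? ?] ?]; rewrite /=; ring. Qed.

Lemma vcross_scale_l (c : R) (u v : vec3) : vcross (vscale c u) v = vscale c (vcross u v).
Proof.
case: u => [[? ?] ?]; case: v => [[? ?] ?]; rewrite /=.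
by congr (_, _, _); ring.
Qed.

Lemma vcross_scale_r (c : R) (u v : vec3) : vcross u (vscale c v) = vscale c (vcross u v).
Proof.
case: u => [[? ?] ?]; case: v => [[? ?] ?]; rewrite /=.
by congr (_, _, _); ring.
Qed.

Lemma vdot_cross_cross (a b c d : vec3) :
  vdot (vcross a b) (vcross c d) = vdot a c * vdot b d - vdot a d * vdot b c.
Proof.
case: a => [[? ?] ?]; case: b => [[? ?] ?]; case: c => [[? ?] ?]; case: d => [[? ?] ?].
by rewrite /=; ring.
Qed.

Lemma vdot_cross_l (a b : vec3) : vdot a (vcross a b) = 0.
Proof. by case: a => [[? ?] ?]; case: b => [[? ?] ?]; rewrite /=; ring. Qed.

Lemma vdot_cross_r (a b : vec3) : vdot b (vcross a b) = 0.
Proof. by case: a => [[? ?] ?]; case: b => [[? ?] ?]; rewrite /=; ring. Qed.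

Lemma vdot_cross_rot (a b c : vec3) : vdot a (vcross b c) = vdot c (vcross a b).
Proof.
case: a => [[? ?] ?]; case: b => [[? ?] ?]; case: c => [[? ?] ?].
by rewrite /=; ring.
Qed.

Lemma vdot_self_ge0 (u : vec3) : 0 <= vdot u u.
Proof. by case: u => [[? ?] ?]; rewrite /=; nra. Qed.

Lemma vnorm_sqr (u : vec3) : vnorm u ^ 2 = vdot u u.
Proof. by apply: pow2_sqrt; exact: vdot_self_ge0. Qed.

Lemma vnorm_gt0 (u : vec3) : u <> vzero -> 0 < vnorm u.
Proof.
case: u => [[a b] c] nz; apply: sqrt_lt_R0; apply: Rnot_le_lt => /= h; apply: nz.
by rewrite /vzero; congr (_, _, _); nra.
Qed.

Lemma vnorm_eq (u : vec3) (c : R) : 0 <= c -> vdot u u = c ^ 2 -> vnorm u = c.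
Proof. by move=> c0 E; rewrite /vnorm E sqrt_pow2. Qed.

Lemma vunit_norm (u : vec3) : u <> vzero -> vdot (vunit u) (vunit u) = 1.
Proof.
move=> /vnorm_gt0 n0; rewrite /vunit vdot_scale_l vdot_scale_r -vnorm_sqr.
by field; lra.
Qed.

Lemma vdot_vunit_l (u v : vec3) : vdot (vunit u) v = / vnorm u * vdot u v.
Proof. exact: vdot_scale_l. Qed.

Lemma vzero_norm : vnorm vzero = 0.
Proof. by rewrite /vnorm /vzero /= !Rmult_0_l !Rplus_0_l sqrt_0. Qed.

(** With [n] and [U] the unit vectors of [x x C] and [C], the angle [g] gives
[Q = U x P = cos g n + sin g (U x n)]; here [n] is orthogonal to [x], while
[U x n] is the unit vector of the projection of [x] to the plane of the ellipse,
whose length is [|x x C| / |C|]. *)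
Lemma perihelion_components (C x P : vec3) (g : R) :
  vcross x C <> vzero -> C <> vzero -> vdot C P = 0 -> vdot P P = 1 ->
  oriented_angle C (vcross x C) (vcross C P) g ->
  vdot x P = - (vnorm (vcross x C) / vnorm C * cos g) /\
  vdot x (vcross (vunit C) P) = vnorm (vcross x C) / vnorm C * sin g.
Proof.
move=> /vnorm_gt0 N0 /[dup] Cz /vnorm_gt0 G0 CP PP; rewrite /oriented_angle.
have G2 := vnorm_sqr C; have N2 := vnorm_sqr (vcross x C).
have -> : vunit (vcross C P) = vcross (vunit C) P.
  rewrite /vunit vcross_scale_l; congr (vscale (/ _) _); apply: vnorm_eq; first lra.
  by rewrite vdot_cross_cross CP PP G2; ring.
have -> : vcross (vunit C) (vunit (vcross x C)) =
    vscale (/ (vnorm C * vnorm (vcross x C))) (vcross C (vcross x C)).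
  rewrite /vunit vcross_scale_l vcross_scale_r.
  case: (vcross C (vcross x C)) => [[? ?] ?]; rewrite /=.
  by congr (_, _, _); field; lra.
move=> E.
have xQ : vdot x (vcross (vunit C) P) = vnorm (vcross x C) / vnorm C * sin g.
  rewrite E vdot_add_r !vdot_scale_r vdot_cross_l.
  rewrite (vdot_cross_rot x C) -N2; field; lra.
split => //.
have -> : vdot x P = vdot (vcross (vunit C) P) (vcross (vunit C) x).
  have CP' : vdot P (vunit C) = 0 by rewrite vdot_scale_r (vdot_comm P) CP; ring.
  by rewrite vdot_cross_cross vunit_norm // CP' (vdot_comm P x); ring.
rewrite E vdot_add_l !vdot_scale_l /vunit !vcross_scale_l !vdot_scale_r.
have -> : vdot (vcross x C) (vcross C x) = - vdot (vcross x C) (vcross x C).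
  by rewrite !vdot_cross_cross (vdot_comm C x); ring.
have -> : vdot (vcross C (vcross x C)) (vcross C x) = 0.
  rewrite vdot_cross_cross !(vdot_comm (vcross x C)) vdot_cross_l vdot_cross_r; ring.
by rewrite -N2; field; lra.
Qed.

Lemma kepler_point_dist2 (C x P : vec3) (a e b g z : R) :
  vcross x C <> vzero -> C <> vzero -> vdot C P = 0 -> vdot P P = 1 ->
  b ^ 2 = 1 - e ^ 2 ->
  oriented_angle C (vcross x C) (vcross C P) g ->
  let q := vadd (vscale (a * (cos z - e)) P)
                (vscale (a * b * sin z) (vcross (vunit C) P)) in
  vdot (vsub x q) (vsub x q) =
  vdot x x + 2 * a * (vnorm (vcross x C) / vnorm C)
     * (cos g * (cos z - e) - b * sin g * sin z)
  + a ^ 2 * (1 - e * cos z) ^ 2.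
Proof.
move=> N0 G0 CP PP be h q.
have [xP xQ] := perihelion_components C x P g N0 G0 CP PP h.
have PQ : vdot P (vcross (vunit C) P) = 0 by rewrite vdot_cross_r.
have QQ : vdot (vcross (vunit C) P) (vcross (vunit C) P) = 1.
  by rewrite vdot_cross_cross PP vunit_norm // vdot_vunit_l CP; ring.
move: xP xQ PQ QQ; set Q := vcross (vunit C) P; set k := _ / _ => xP xQ PQ QQ.
rewrite vdot_sub_self /q vdot_add_l !vdot_add_r !vdot_scale_l !vdot_scale_r (vdot_comm Q P).
rewrite xP xQ PQ QQ PP.
have cs := cos2_sin2 z.
have s2 : sin z ^ 2 = 1 - cos z ^ 2 by lra.
transitivity (vdot x x + 2 * a * k * (cos g * (cos z - e) - b * sin g * sin z)
   + a ^ 2 * ((cos z - e) ^ 2 + b ^ 2 * sin z ^ 2)); first by ring.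
by rewrite be s2; ring.
Qed.

Lemma ecc_vector_orth (m M : R) (y x : vec3) :
  vdot (ang_mom y x) (ecc_vector m M y x) = 0.
Proof.
rewrite /ecc_vector /vsub vdot_add_r !vdot_scale_r vdot_cross_r.
by rewrite /ang_mom (vdot_comm _ x) vdot_cross_l; ring.
Qed.

(** Expand the square, with [|y x C| = |y| |C|] and [(y x C) . x = |C| ^ 2]. *)
Lemma eccentricity_sqr (m M : R) (y x : vec3) :
  0 < m -> 0 < M -> x <> vzero ->
  eccentricity m M y x ^ 2 =
  1 + 2 * vnorm (ang_mom y x) ^ 2 * kepler_energy m M y x / (m ^ 3 * M ^ 2).
Proof.
move=> m0 M0 /[dup] xz /vnorm_gt0 x0.
rewrite /eccentricity /kepler_energy !vnorm_sqr /ecc_vector.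
set C := ang_mom y x; set W := vcross y C.
rewrite vdot_sub_self vunit_norm // !vdot_scale_r !vdot_scale_l.
have yC : vdot y C = 0 by exact: vdot_cross_r.
have WW : vdot W W = vdot y y * vdot C C.
  by rewrite /W vdot_cross_cross yC; ring.
have Wx : vdot W x = vdot C C.
  by rewrite vdot_comm /W vdot_cross_rot.
rewrite WW Wx.
by field; repeat split; lra.
Qed.

(** * The averaged potential in the canonical coordinates *)

Lemma vsub_eq0 (u v : vec3) : vsub u v = vzero -> u = v.
Proof.
case: u => [[? ?] ?]; case: v => [[? ?] ?]; rewrite /vsub /vzero /= => -[? ? ?].
by congr (_, _, _); lra.
Qed.

Lemma vcross_zero_l (v : vec3) : vcross vzero v = vzero.
Proof. by case: v => [[? ?] ?]; rewrite /vzero /=; congr (_, _, _); ring. Qed.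

Lemma vcross_zero_r (v : vec3) : vcross v vzero = vzero.
Proof. by case: v => [[? ?] ?]; rewrite /vzero /=; congr (_, _, _); ring. Qed.

Lemma orbit_elements (m M : R) (y x : vec3) :
  0 < m -> 0 < M -> x <> vzero -> kepler_energy m M y x < 0 ->
  ang_mom y x <> vzero -> eccentricity m M y x <> 0 ->
  let L := m * sqrt (M * semi_major m M y x) in
  let G := vnorm (ang_mom y x) in
  0 < G < L /\ a2K m M L = semi_major m M y x /\
  eccentricity m M y x = sqrt (1 - G ^ 2 / L ^ 2) /\
  sqrt (1 - eccentricity m M y x ^ 2) = G / L.
Proof.
move=> m0 M0 xz; set H := kepler_energy m M y x => H0 /vnorm_gt0 G0 e0 L G.
have a0 : 0 < semi_major m M y x.
  rewrite /semi_major -/H; have -> : - (m * M) / (2 * H) = m * M / (2 * - H) by field; lra.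
  by apply: Rdiv_lt_0_compat; nra.
have Ma : 0 < M * semi_major m M y x by nra.
have L0 : 0 < L by apply: Rmult_lt_0_compat => //; exact: sqrt_lt_R0.
have L2 : L ^ 2 = m ^ 2 * (M * semi_major m M y x).
  by rewrite /L Rpow_mult_distr pow2_sqrt //; lra.
have e2 : eccentricity m M y x ^ 2 = 1 - G ^ 2 / L ^ 2.
  by rewrite eccentricity_sqr // -/H -/G L2 /semi_major -/H; field; repeat split; lra.
have ep : 0 <= eccentricity m M y x by exact: sqrt_pos.
have GL : 0 < 1 - G ^ 2 / L ^ 2 by rewrite -e2; nra.
rewrite -/G in G0.
split.
  split => //; apply: Rnot_le_lt => h.
  have : 1 <= G ^ 2 / L ^ 2.
    by apply/Rle_div_r; nra.
  lra.
split; first by rewrite /a2K L2; field; lra.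
split; first by rewrite -e2 sqrt_pow2.
rewrite e2; have -> : 1 - (1 - G ^ 2 / L ^ 2) = (G / L) ^ 2 by field; lra.
by rewrite sqrt_pow2 //; apply: Rmult_le_pos; [lra|apply/Rlt_le/Rinv_0_lt_compat].
Qed.

(** [Theta / G2] is the cosine of the angle between [C] and [x], and the square
root is its sine. *)
Lemma vnorm_cross_angle (C x : vec3) :
  x <> vzero -> C <> vzero ->
  vnorm (vcross x C) / vnorm C =
  vnorm x * sqrt (1 - (vdot C x / vnorm x) ^ 2 / vnorm C ^ 2).
Proof.
move=> /vnorm_gt0 r0 /vnorm_gt0 G0.
have r2 := vnorm_sqr x; have G2 := vnorm_sqr C.
have E : vnorm (vcross x C) ^ 2 =
    (vnorm x * vnorm C) ^ 2 * (1 - (vdot C x / vnorm x) ^ 2 / vnorm C ^ 2).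
  rewrite vnorm_sqr vdot_cross_cross (vdot_comm x C) -r2 -G2; field; lra.
have -> : vnorm (vcross x C) = sqrt (vnorm (vcross x C) ^ 2).
  by rewrite sqrt_pow2 //; exact: sqrt_pos.
rewrite E sqrt_mult_alt; last exact: pow2_ge_0.
rewrite sqrt_pow2; last by nra.
by field; lra.
Qed.

(** The angle [g2] from [nu2] to [nu3] locates [x1] relative to the perihelion;
the squared distance is then that of [dist2K], and Kepler's equation turns the
integral over the mean anomaly into one over the eccentric anomaly. *)
Lemma K_expression (F : frame) (m M : R) (s : phase_point) (k : Kcoords) :
  0 < m -> 0 < M -> K_coordinates F m M s k -> off_ellipse m M s ->
  K_domain m M (cr1 k) (cLambda2 k) (cTheta k) (cG2 k) (cg2 k) /\
  h2 m M s = h2K m M (cr1 k) (cLambda2 k) (cTheta k) (cG2 k) (cg2 k).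
Proof.
move=> m0 M0 [[[xz [H0 e0]] [_ [_ [nu2z _]]]] [[_ [_ [_ [EL [EG ET]]]]] [_ [_ [Er [_ [Eg _]]]]]]] off.
have Cz : C2 s <> vzero by move=> h; apply: nu2z; rewrite /nu2 h vcross_zero_r.
have x1z : x1 s <> vzero by move=> h; apply: nu2z; rewrite /nu2 h vcross_zero_l.
have [GL [Ea [Ee Eb]]] := orbit_elements m M (y2 s) (x2 s) m0 M0 xz H0 Cz e0.
rewrite -EL in GL Ea Ee Eb; rewrite -[vnorm (ang_mom _ _)]EG in GL Ee Eb.
set e := eccentricity m M (y2 s) (x2 s) in e0 Ee Eb.
have ep : 0 < e by have : 0 <= e; [exact: sqrt_pos|lra].
have be : sqrt (1 - e ^ 2) ^ 2 = 1 - e ^ 2.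
  rewrite Eb Ee pow2_sqrt; first by field; lra.
  apply: Rnot_lt_le => h; rewrite Ee sqrt_neg_0 in ep; lra.
have G0 := vnorm_gt0 _ Cz; have r0 := vnorm_gt0 _ x1z.
set P := perihelion_dir m M (y2 s) (x2 s) in Eg.
have Pu : vdot P P = 1.
  apply: vunit_norm => h; apply: e0; rewrite /e /eccentricity h; exact: vzero_norm.
have CP : vdot (C2 s) P = 0.
  by rewrite /P /perihelion_dir vdot_scale_r ecc_vector_orth; ring.
have Nk := vnorm_cross_angle (C2 s) (x1 s) x1z Cz.
have D z : dist2K m M (cr1 k) (cLambda2 k) (cTheta k) (cG2 k) (cg2 k) z =
    vdot (vsub (x1 s) (kepler_point m M (y2 s) (x2 s) z))
         (vsub (x1 s) (kepler_point m M (y2 s) (x2 s) z)).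
  rewrite /kepler_point -/e -/P.
  rewrite (kepler_point_dist2 (C2 s) (x1 s) P _ e _ (cg2 k) z nu2z Cz CP Pu be Eg).
  rewrite Nk -ET -EG -Er Eb /dist2K /rho2 -Ee Ea -vnorm_sqr -Er.
  by rewrite /Rdiv; ring.
have D0 z : 0 < dist2K m M (cr1 k) (cLambda2 k) (cTheta k) (cG2 k) (cg2 k) z.
  rewrite D -vnorm_sqr; apply/pow_lt/vnorm_gt0 => /vsub_eq0; exact: off.
have dom : K_domain m M (cr1 k) (cLambda2 k) (cTheta k) (cG2 k) (cg2 k).
  split; first by rewrite Er.
  split; last by split => //; lra.
  have N0 := vnorm_gt0 _ nu2z; rewrite /nu2 in N0.
  have : 0 < vnorm (vcross (x1 s) (C2 s)) / vnorm (C2 s) by apply: Rdiv_lt_0_compat.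
  rewrite Nk -ET -EG => h.
  have h1 : 0 < 1 - cTheta k ^ 2 / cG2 k ^ 2.
    apply: Rnot_le_lt => h1; rewrite sqrt_neg_0 // in h; lra.
  have h2 : cTheta k ^ 2 < cG2 k ^ 2.
    by apply/(Rdiv_lt_1 _ _ _); [apply: pow_lt; lra|lra].
  by apply: Rabs_def1; nra.
split => //.
have he1 : 0 <= e < 1.
  have gl : 0 < cG2 k / cLambda2 k by apply: Rdiv_lt_0_compat; lra.
  by rewrite -Eb in gl; split; nra.
have f0 z : 0 < vnorm (vsub (x1 s) (kepler_point m M (y2 s) (x2 s) z)).
  by apply: vnorm_gt0 => /vsub_eq0; exact: off.
rewrite /h2 /h2K; congr (_ * _).
rewrite /kepler_position -/e.
rewrite (RInt_mean_anomaly e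
  (fun z => / vnorm (vsub (x1 s) (kepler_point m M (y2 s) (x2 s) z))) he1).
  apply: RInt_ext => z _; rewrite /rho2 -Ee D; by [].
move=> z; apply: (continuous_ext
    (fun z => / sqrt (dist2K m M (cr1 k) (cLambda2 k) (cTheta k) (cG2 k) (cg2 k) z))).
  by move=> z'; rewrite D.
set D2 := dist2K m M _ _ _ _ _.
apply: (continuous_comp (fun z => sqrt (D2 z)) Rinv).
  apply: (continuous_comp D2 sqrt); last exact: continuous_sqrt.
  by apply: ex_derive_continuous; rewrite /D2 /dist2K /rho2; auto_derive.
by apply: continuous_Rinv; apply/Rgt_not_eq/sqrt_lt_R0/D0.
Qed.

Theorem proposition6 (m2 M2 : R) (hm2 : 0 < m2) (hM2 : 0 < M2)
    (F : frame) (hF : orthonormal F) :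
  (* expression of h2 in the coordinates K *)
  (forall (s : phase_point) (k : Kcoords),
     K_coordinates F m2 M2 s k -> off_ellipse m2 M2 s ->
     K_domain m2 M2 (cr1 k) (cLambda2 k) (cTheta k) (cG2 k) (cg2 k) /\
     h2 m2 M2 s = h2K m2 M2 (cr1 k) (cLambda2 k) (cTheta k) (cG2 k) (cg2 k)) /\
  renormalizably_integrable (D_K m2 M2) I_K (hat (h2K m2 M2)) (hat (E0 m2 M2)) /\
  exists htilde2 : R -> R -> R -> R -> R,
    forall r1 Lambda2 Theta G2 g2 : R,
      K_domain m2 M2 r1 Lambda2 Theta G2 g2 ->
      h2K m2 M2 r1 Lambda2 Theta G2 g2
      = htilde2 r1 Lambda2 Theta (E0 m2 M2 r1 Lambda2 Theta G2 g2).
Proof.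
have [ht Ht] := h2K_factors m2 M2 hm2 hM2.
split; first by move=> s k; exact: K_expression.
split; last by exists ht.
split.
  move=> p q y x _; split; first by move=> i; exact: I_K_has_partials.
  by move=> i j; exact: I_K_commute.
exists (fun v E => ht (v i0) (v i1) (v i2) E) => p q y x; exact: Ht.
Qed.
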